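(* Let $T:J\to\mathbb{R}$ be a saw map satisfying the standing assumptions (all notation as defined in the context). (a) If $\beta_k<1$ for some $1\le k\le k^*$, then the interval $J_k$ is invariant and $J_k\setminus\{e_k\}$ belongs to the basin of attraction of the stable fixed point $\hat e_k\in J_k$. (b) If $\beta_k>1$ and $\alpha_k^{-1}+\beta_k^{-1}>1$ for some $1\le k\le k^*$, then the interval $J_k$ is also invariant. Further, the interval $G_k\subset J_k$ is invariant and contains a chaotic invariant set $$\Lambda_k=\bigcup_{i=1}^{2^N}\overline{A_i}$$ (for some integer $N\ge 0$), where the $A_i$ are non-intersecting open intervals. The complement $G_k\setminus\Lambda_k$ contains $N$ unstable periodic orbits $O_1,\dots,O_N$ of periods $1,2,4,\ldots,2^{N-1}$. Furthermore, for any $x\in G_k\setminus(\Lambda_k\cup O_1\cup\cdots\cup O_N)$ there is an $n_0$ such that $T^n(x)\in\Lambda_k$ for $n\ge n_0$, and for any $y\in J_k\setminus(G_k\cup\{e_k\})$ there is an $n_1$ such that $T^n(y)\in G_k$ for $n\ge n_1$. (c) If $\alpha_k^{-1}+\beta_k^{-1}<1$ for some $1\le k\le k^*-1$, then the interval $J_k$ contains a chaotic invariant Cantor set $\Lambda_k$, the dynamics of $T$ on this set is conjugate to the left shift (on one-sided infinite sequences of two symbols), and for every $x\in J_k\setminus\Lambda_k$ there is an $n_2$ such that $T^n(x)\in[0,e_k)$ for $n\ge n_2$.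
   Context: Saw map. Let $(p_k)_{k\ge0}$, $(r_k)_{k\ge0}$, $(q_k)_{k\ge1}$ be real sequences with $r_0>q_1>r_1>q_2>r_2>\cdots>0$, $q_k\to0$, $r_k\to 0$; $p_0>p_1>p_2>\cdots>0$; $p_0<r_0$; and $p_k>r_k$ for all $k\ge1$. Put $J=[0,r_0]$ and let $T:J\to\mathbb{R}$ be the map with $T(0)=T(q_k)=0$ for $k\ge1$, $T(r_k)=p_k$ for $k\ge0$, and $T$ linear (i.e. affine) on each of the intervals $[q_{k+1},r_k]$, $[r_k,q_k]$ ($k\ge1$) and $[q_1,r_0]$. Then $T(J)\subset J$. For $k\ge1$, $T$ has a unique fixed point $e_k$ in $(q_{k+1},r_k)$ and a unique fixed point $\hat e_k$ in $(r_k,q_k)$. Let $\alpha_k=p_k/(r_k-q_{k+1})$ ($k\ge0$) and $\beta_k=p_k/(q_k-r_k)$ ($k\ge1$) be the absolute values of the slopes of $T$ on $[q_{k+1},r_k]$ and $[r_k,q_k]$. Standing assumptions: (1) the sequences $\alpha_k$ and $\beta_k$ are increasing; (2) there exists $k^*\ge1$ such that $p_k>e_{k-1}$ for all $k\ge k^*+1$ and, if $k^*\ge2$, $p_k<e_{k-1}$ for $2\le k\le k^*$; (3) $q_k+\frac{e_k}{\alpha_{k-1}}>p_k$ for $1\le k\le k^*-1$. Notation: for $1\le k\le k^*$, $J_k=[e_k,p_k]$ and $G_k=[T^2(r_k),T(r_k)]=[T(p_k),p_k]$. $\overline A$ is the closure of $A$. A set $A$ is invariant for $T$ if $T(A)\subseteq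 A$. A closed invariant set $A$ for a map $f$ is called chaotic (Devaney) if: periodic points of $f$ are dense in $A$; there is $\beta>0$ such that for any $x\in A$ and any $\epsilon>0$ there are $y\in A$ with $|x-y|<\epsilon$ and $k$ with $|f^k(x)-f^k(y)|>\beta$; and $A$ contains a dense orbit of $f$.
   Formalization: In (b), the claim that T^n(x) is eventually in Λ_k is stated only for those x in G_k∖(Λ_k∪O_1∪⋯∪O_N) whose orbit never meets O_2,…,O_N, since points that land on such an O_j never enter Λ_k. *)

(* Defs.v *)
From HB Require Import structures.
From mathcomp Require Import all_boot all_order all_algebra.
From mathcomp Require Import all_classical all_reals all_analysis.

Set Implicit Arguments.
Unset Strict Implicit.
Unset Printing Implicit Defensive.

Import Order.TTheory GRing.Theory Num.Theory.
Import numFieldNormedType.Exports.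

Local Open Scope classical_set_scope.
Local Open Scope ring_scope.

Section dynamics.
Context {R : realType}.
Implicit Types (D A O : set R) (f : R -> R).

Definition invariant_set f A : Prop := f @` A `<=` A.

(* Stability is relative to the phase space D, since a map of D is represented
   by a total function R -> R whose values outside D are irrelevant. *)
Definition stable_set D f O : Prop :=
  forall U : set R, open U -> O `<=` U ->
  exists V : set R, [/\ open V, O `<=` V &
    forall x, V x -> D x -> forall n, U (iter n f x)].

Definition basin D f (a : R) : set R :=
  [set x | D x /\ iter n f x @[n --> \oo] --> a].

Definition orbit_of f (x : R) : set R := range (fun n => iter n f x).

Definition has_least_period f (n : nat) (x : R) : Prop :=
  [/\ (0 < n)%N, iter n f x = x &
    forall m, (0 < m < n)%N -> iter m f x <> x].

Definition periodic_orbit f (n : nat) O : Prop :=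
  exists2 x, has_least_period f n x & O = orbit_of f x.

Definition periodic_points f : set R :=
  [set x | exists n, has_least_period f n x].

Definition sensitive_on f A : Prop :=
  exists2 beta : R, 0 < beta &
  forall x, A x -> forall eps : R, 0 < eps ->
  exists y, [/\ A y, `|x - y| < eps &
    exists k, beta < `|iter k f x - iter k f y|].

Definition devaney_chaotic f A : Prop :=
  [/\ closed A,
      invariant_set f A,
      A `<=` closure (A `&` periodic_points f),
      sensitive_on f A &
      exists2 x, A x & A `<=` closure (orbit_of f x)].

Definition cantor_set A : Prop :=
  [/\ A !=set0, compact A, perfect_set A & totally_disconnected A].

(* cantor_space carries the product topology of nat -> bool. *)
Definition shift (s : cantor_space) : cantor_space := fun n => s n.+1.

(* h restricts to a homeomorphism from A onto cantor_space, with inverse g. *)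
Definition conjugate_to_shift f A : Prop :=
  exists (h : R -> cantor_space) (g : cantor_space -> R),
    [/\ {within A, continuous h}, continuous g,
        (forall s, A (g s)), cancel g h &
        forall x, A x -> g (h x) = x /\ h (f x) = shift (h x)].

Definition affine_on (a b : R) f : Prop :=
  exists m c : R, forall x, x \in `[a, b] -> f x = m * x + c.

(* The value q 0 plays no role. *)
Record saw_map (p r q : nat -> R) (T : R -> R) : Prop := SawMap {
  saw_qr : forall k, q k.+1 < r k;
  saw_rq : forall k, r k.+1 < q k.+1;
  saw_r_gt0 : forall k, 0 < r k;
  saw_q_gt0 : forall k, 0 < q k.+1;
  saw_q_cvg : q @ \oo --> (0 : R);
  saw_r_cvg : r @ \oo --> (0 : R);
  saw_p_decr : forall k, p k.+1 < p k;
  saw_p_gt0 : forall k, 0 < p k;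
  saw_p0_r0 : p 0%N < r 0%N;
  saw_rp : forall k, r k.+1 < p k.+1;
  saw_T0 : T 0 = 0;
  saw_Tq : forall k, T (q k.+1) = 0;
  saw_Tr : forall k, T (r k) = p k;
  saw_affine_up : forall k, affine_on (q k.+1) (r k) T;
  saw_affine_down : forall k, affine_on (r k.+1) (q k.+1) T
}.

Variables (p r q : nat -> R) (T : R -> R).

Definition sawJ : set R := [set` `[0, r 0%N]].

(* For a saw map and 1 <= k these sets of fixed points are singletons, so that
   get (the choice of an element) returns the unique fixed point. *)
Definition saw_e (k : nat) : R :=
  get [set x | q k.+1 < x < r k /\ T x = x].

Definition saw_ehat (k : nat) : R :=
  get [set x | r k < x < q k /\ T x = x].

Definition saw_alpha (k : nat) : R := p k / (r k - q k.+1).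

Definition saw_beta (k : nat) : R := p k / (q k - r k).

Definition sawJk (k : nat) : set R := [set` `[saw_e k, p k]].

Definition sawG (k : nat) : set R := [set` `[T (T (r k)), T (r k)]].

Record saw_assumptions (kst : nat) : Prop := SawAssumptions {
  saw_alpha_incr : nondecreasing_seq saw_alpha;
  saw_beta_incr : nondecreasing_seq (fun k => saw_beta k.+1);
  saw_kst_ge1 : (1 <= kst)%N;
  saw_p_gt_e : forall k, (kst.+1 <= k)%N -> saw_e k.-1 < p k;
  saw_p_lt_e : forall k, (2 <= k <= kst)%N -> p k < saw_e k.-1;
  saw_no_return : forall k, (1 <= k <= kst.-1)%N ->
    p k < q k + saw_e k / saw_alpha k.-1
}.

End dynamics.

(* Main.v *)
Require Import Defs.
From HB Require Import structures.
From mathcomp Require Import all_boot all_order all_algebra.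
From mathcomp Require Import all_classical all_reals all_analysis.
From mathcomp Require Import ring lra.

Set Implicit Arguments.
Unset Strict Implicit.
Unset Printing Implicit Defensive.

Import Order.TTheory GRing.Theory Num.Theory.
Import numFieldNormedType.Exports.

Local Open Scope classical_set_scope.
Local Open Scope ring_scope.

(** Between two consecutive zeros q_(k+1) < q_k the saw map is a skew tent map,
    with slopes alpha_k and - beta_k, and it is conveniently replaced there by
    the tent map F, the minimum of two affine functions, which is continuous on
    the whole line. Write e, h for the fixed points of F on its rising and falling
    sides, p for its peak value, and a, b for the absolute values of its slopes.
    The sign of F p - e is that of alpha_k^-1 + beta_k^-1 - 1
    ([saw_image_peak]); and as the sum of the inverse slopes is also
    (q_k - q_(k+1)) / p_k, the tooth contains J_k when the sum exceeds 1
    ([saw_inverse_slopes]).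

    If beta_k < 1, the falling side is mapped into itself and F contracts there
    towards h, while the rising side expels every point but e
    ([saw_attracting]).

    If beta_k > 1 and F p > e, the core [F p, p] is invariant and absorbs J_k
    except for e. Two situations occur. When F (F p) <= h, iterates of any interval
    stretch until they spread alternately over the two halves [F p, h] and
    [h, p] of the core: an interval loses length only when it is folded at the
    turning point, and the inequality a + b <= a b^2, which is what F (F p) <= h
    says about the slopes, makes up for the fold ([covers_fixed],
    [covers_halves]). The core is then chaotic. When F (F p) > h, the map F
    exchanges the two sides of h in the core, and F o F restricted to [h, p] is
    again a skew tent map, with slopes b^2 and a b ([renorm_tent_eq]). A
    decomposition for F o F is doubled into one for F, at the cost of the fixed
    point h, which is repelling and has no other preimage in the core
    ([cascade_double]). A common lower bound of the slopes is squared each time,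
    and slopes of at least 2 would keep F p from exceeding e, so the process stops ([tent_cascade]); the number of
    renormalizations is the integer N.

    If F p < e, the points whose orbits stay in J_k avoid a gap around the turning
    point, and the two inverse branches of F are contractions: each sequence of
    branches is followed by exactly one point. This gives the conjugacy with the
    shift, from which chaos and the Cantor property are read
    ([itinerary_point], [horseshoe_properties]). A point that leaves this set is
    sent into [0, e), either by F or, beyond q_k, by the next rising side, whose
    reach is limited by the third standing assumption; and [0, e) is invariant
    since the lower peaks are below e ([saw_below_e], [saw_horseshoe]). *)

(** * Dynamics of continuous maps of the line *)

Section line_dynamics.
Context {R : realType}.
Implicit Types (A L : set R) (f g : R -> R).

Lemma set_itvccP (lo hi x : R) : [set` `[lo, hi]] x <-> lo <= x <= hi.
Proof. by rewrite /= in_itv. Qed.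

Lemma closure_distP A (x : R) :
  closure A x <-> forall eps : R, 0 < eps -> exists2 y, A y & `|x - y| < eps.
Proof.
split=> [clx eps eps0 | H B /nbhs_ballP[eps /= eps0 sub]].
  have [y [Ay By]] := clx _ (nbhsx_ballx x _ eps0); exists y => //.
by have [y Ay xy] := H _ eps0; exists y; split => //; apply: sub.
Qed.

Lemma continuous_distP f (x eps : R) : continuous f -> 0 < eps ->
  exists2 d : R, 0 < d & forall y, `|x - y| < d -> `|f x - f y| < eps.
Proof.
move=> fc eps0.
have /nbhs_ballP[d /= d0 sub] := fc x _ (nbhsx_ballx (f x) _ eps0).
by exists d => // y /sub.
Qed.

Lemma iter_continuous f n : continuous f -> continuous (iter n f).
Proof.
move=> fc; elim: n => [|n IH] x; first exact: cvg_id.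
by apply: continuous_comp; [exact: IH | exact: fc].
Qed.

Lemma invariant_iter f A x n : invariant_set f A -> A x -> A (iter n f x).
Proof. by move=> inv Ax; elim: n => //= n IH; apply: inv; exists (iter n f x). Qed.

Lemma eq_iter_in f g A : invariant_set g A -> {in A, f =1 g} ->
  forall x n, A x -> iter n f x = iter n g x.
Proof.
move=> inv fg x n Ax; elim: n => //= n ->.
by apply: fg; apply: mem_set; apply: invariant_iter.
Qed.

Lemma iter_double f n x : iter n (f \o f) x = iter n.*2 f x.
Proof. by elim: n => //= n ->. Qed.

Lemma continuous_image_closure f A x : continuous f -> closure A x ->
  closure (f @` A) (f x).
Proof.
move=> fc /closure_distP cl; apply/closure_distP => eps eps0.
have [d d0 fd] := continuous_distP x fc eps0.
have [y Ay xy] := cl _ d0.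
by exists (f y); [exists y | apply: fd].
Qed.

Lemma periodic_pointP f x n : (0 < n)%N -> iter n f x = x ->
  periodic_points f x.
Proof.
move=> n0 fx.
have ex : exists m, (0 < m)%N && (iter m f x == x) by exists n; rewrite n0 fx/=.
have [m /andP[m0 /eqP fm] mmin] := ex_minnP ex.
exists m; split => // i /andP[i0 im] /eqP fi.
by have := mmin i; rewrite i0 fi /= => /(_ isT); rewrite leqNgt im.
Qed.

(** Chaos on an invariant set depends only on the restriction of the map; a saw map
    can thus be exchanged for a continuous model. *)
Lemma eq_devaney_chaotic f g A : invariant_set g A -> {in A, f =1 g} ->
  devaney_chaotic g A -> devaney_chaotic f A.
Proof.
move=> inv fg [cl _ per [beta beta0 sens] [x Ax dx]].
have E := eq_iter_in inv fg; split => //.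
- by move=> _ [y Ay <-]; rewrite fg ?inE//; apply: inv; exists y.
- move=> y /per; apply: closureS => z [Az [n [n0 gz gmin]]].
  split => //; exists n; split; rewrite ?E// => m /gmin; by rewrite E.
- exists beta => // y Ay eps eps0.
  have [z [Az yz [k bk]]] := sens _ Ay _ eps0.
  by exists z; split => //; exists k; rewrite !E.
- exists x => // y /dx; apply: closureS => _ [n _ <-].
  by exists n => //; rewrite E.
Qed.

(** The supremum of the left ends lies in all the balls. *)
Lemma nested_balls (x rho : nat -> R) : (forall n, 0 < rho n) ->
  (forall n, `|x n - x n.+1| + rho n.+1 <= rho n) ->
  exists a, forall n, `|x n - a| <= rho n.
Proof.
move=> rho0 nest.
have lemono : forall m n, (m <= n)%N -> x m - rho m <= x n - rho n.
  move=> m n /subnK <-; elim: (n - m)%N => // k IH.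
  apply: le_trans IH _; rewrite addSn; have := nest (k + m)%N.
  have := ler_norm (x (k + m)%N - x (k + m).+1); lra.
have gemono : forall m n, (m <= n)%N -> x n + rho n <= x m + rho m.
  move=> m n /subnK <-; elim: (n - m)%N => // k IH.
  apply: le_trans IH; rewrite addSn; have := nest (k + m)%N.
  have := ler_norm (x (k + m).+1 - x (k + m)%N); rewrite distrC; lra.
have cross : forall m n, x m - rho m <= x n + rho n.
  move=> m n; have h1 := lemono _ _ (leq_maxl m n).
  have h2 := gemono _ _ (leq_maxr m n); have := rho0 (maxn m n); lra.
pose E := range (fun n => x n - rho n).
exists (sup E) => n.
have supE : has_sup E.
  split; first by exists (x 0%N - rho 0%N), 0%N.
  by exists (x 0%N + rho 0%N) => _ [m _ <-].
have h1 : x n - rho n <= sup E by apply: sup_upper_bound => //; exists n.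
have h2 : sup E <= x n + rho n.
  by apply: ge_sup => [|_ [m _ <-]]; first exact: supE.1.
by rewrite ler_norml; apply/andP; split; lra.
Qed.

(** Birkhoff's transitivity theorem: nested balls are built which iterates of
    f carry, one after the other, into each ball of a countable base that meets A;
    the common point has a dense orbit. *)
Lemma transitive_dense_orbit f A : continuous f -> closed A -> A !=set0 ->
  (forall x y eps : R, A x -> A y -> 0 < eps ->
     exists z, [/\ A z, `|x - z| < eps & exists n, `|iter n f z - y| < eps]) ->
  exists2 x, A x & A `<=` closure (orbit_of f x).
Proof.
move=> fc clA [x0 Ax0] trans.
(* (q, j) codes the ball of centre q and radius 1/(j+1) *)
pose meets (c : rat * nat) y := `|ratr c.1 - y| < c.2.+1%:R^-1 :> R.
pose step (c : rat * nat) (xr yr : R * R) :=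
  [/\ A yr.1, 0 < yr.2 <= xr.2 / 2, `|xr.1 - yr.1| + yr.2 <= xr.2 &
    (exists2 y, A y & meets c y) ->
    forall z, `|yr.1 - z| <= yr.2 -> exists n, meets c (iter n f z)].
have stepE c xr : A xr.1 -> 0 < xr.2 -> exists yr, step c xr yr.
  case: xr => x rho /= Ax rho0.
  have [[y Ay cy]|nc] := pselect (exists2 y, A y & meets c y); last first.
    exists (x, rho / 2); split => //=; last by rewrite subrr normr0; lra.
    by rewrite lexx andbT; lra.
  pose gap := c.2.+1%:R^-1 - `|ratr c.1 - y| : R.
  have gap0 : 0 < gap by rewrite subr_gt0.
  have eps0 : 0 < Num.min (rho / 2) (gap / 2).
    by rewrite lt_min; apply/andP; split; lra.
  have [z [Az xz [n nz]]] := trans _ _ _ Ax Ay eps0.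
  move: xz nz; rewrite !lt_min => /andP[xz _] /andP[_ nz].
  have gap20 : 0 < gap / 2 by lra.
  have [d d0 fd] := continuous_distP z (@iter_continuous f n fc) gap20.
  exists (z, Num.min (rho / 2) (d / 2)); split => //=.
  - by rewrite lt_min ge_min lexx /= andbT; apply/andP; split; lra.
  - have : Num.min (rho / 2) (d / 2) <= rho / 2 by rewrite ge_min lexx.
    lra.
  - move=> _ w; rewrite le_min => /andP[_ zw]; exists n.
    have /fd fw : `|z - w| < d by lra.
    rewrite /meets.
    have := ler_distD y (ratr c.1) (iter n f w).
    have := ler_distD (iter n f z) y (iter n f w).
    rewrite (distrC y (iter n f z)); move: nz fw; rewrite /gap.
    by move: (_^-1) => rad *; lra.
pose code n : rat * nat := odflt (0, 0%N) (unpickle n).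
pose state := {xr : R * R | A xr.1 /\ 0 < xr.2}.
have nextE (n : nat) (s : state) : {t : state | step (code n) (sval s) (sval t)}.
  apply: cid; case: s => xr /= [Ax rho0].
  have [yr yrP] := stepE (code n) xr Ax rho0.
  by case: (yrP) => Ay /andP[yr0 _] _ _; exists (exist _ yr (conj Ay yr0)).
have st0 : A (x0, 1 : R).1 /\ 0 < (x0, 1 : R).2 by [].
pose s := fix s n : state :=
  if n is m.+1 then sval (nextE m (s m)) else exist _ (x0, 1) st0.
have sP n : step (code n) (sval (s n)) (sval (s n.+1)).
  exact: (svalP (nextE n (s n))).
pose x n := (sval (s n)).1; pose rho n := (sval (s n)).2.
have rho0 n : 0 < rho n := (svalP (s n)).2.
have Ax n : A (x n) := (svalP (s n)).1.
have [|a aP] := @nested_balls x rho rho0.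
  by move=> n; have [] := sP n.
have rhohalf n : rho n <= (2 ^+ n)^-1.
  elim: n => [|n IH]; first by rewrite expr0 invr1.
  have [_ /andP[_ h] _ _] := sP n.
  rewrite -/(rho n) -/(rho n.+1) in h; rewrite exprS invfM.
  lra.
have Aa : A a.
  have -> : A = closure A by exact/closure_id.
  apply/closure_distP => eps eps0.
  exists (x (Num.bound eps^-1)) => //.
  rewrite distrC; apply: le_lt_trans (aP _) _; apply: le_lt_trans (rhohalf _) _.
  rewrite invf_plt ?posrE ?exprn_gt0//.
  apply: lt_trans (archi_boundP _) _; first by rewrite invr_ge0 ltW.
  by rewrite -natrX ltr_nat ltn_expl.
exists a => // y Ay; apply/closure_distP => eps eps0.
(* a ball of the base around y, of diameter less than eps *)
pose j := Num.bound (2 / eps).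
have hj : 2 / eps < j.+1%:R.
  apply: lt_trans (archi_boundP _) _; first by rewrite divr_ge0// ltW.
  by rewrite ltr_nat.
have : j.+1%:R^-1 < eps / 2.
  by rewrite invf_plt ?posrE ?divr_gt0//; rewrite invf_div.
have : 0 < (j.+1%:R^-1 : R) by rewrite invr_gt0.
move radE : (j.+1%:R^-1) => rad rad0 radeps.
have [c] := @rat_in_itvoo R (y - rad) (y + rad) ltac:(lra).
rewrite in_itv /= => /andP[c1 c2].
have cy : meets (c, j) y by rewrite /meets/= radE ltr_norml; apply/andP; split; lra.
have codeE : code (pickle (c, j)) = (c, j) by rewrite /code pickleK.
have [_ _ _] := sP (pickle (c, j)); rewrite codeE => /(_ _ a (aP _)).
have ey : exists2 y, A y & meets (c, j) y by exists y.
case/(_ ey) => n; rewrite /meets /= radE => mn.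
exists (iter n f a); first by exists n.
have := ler_distD (ratr c) y (iter n f a).
rewrite /meets /= radE in cy; rewrite (distrC y (ratr c)); lra.
Qed.

(** If f o f is chaotic on L then f is chaotic on L and its image together: a
    point of f(L) is dealt with through a preimage in L. *)
Lemma devaney_chaotic_double f L : continuous f -> compact L ->
  devaney_chaotic (f \o f) L -> devaney_chaotic f (L `|` f @` L).
Proof.
move=> fc cL [clL inv per [beta beta0 sens] [x Lx dx]].
have Lff y : L y -> L (f (f y)) by move=> Ly; apply: inv; exists y.
have orb y : orbit_of (f \o f) y `<=` orbit_of f y.
  by move=> _ [n _ <-]; exists n.*2 => //; rewrite iter_double.
have orb' y : f @` orbit_of (f \o f) y `<=` orbit_of f y.
  by move=> _ [_ [n _ <-] <-]; exists n.*2.+1 => //; rewrite iter_double.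
split.
- apply: closedU => //; apply: compact_closed; first exact: Rhausdorff.
  by apply: continuous_compact => //; exact: continuous_subspaceT.
- move=> _ [y [Ly|[z Lz <-]] <-]; first by right; exists y.
  by left; apply: Lff.
- have per2 y : L y -> periodic_points (f \o f) y -> periodic_points f y.
    move=> Ly [n [n0 fy _]]; apply: (@periodic_pointP _ _ n.*2).
      by rewrite double_gt0.
    by rewrite -iter_double.
  move=> y [Ly|[z Lz <-]].
    move: (per _ Ly); apply: closureS => z [Lz pz]; split; first by left.
    exact: per2.
  have := continuous_image_closure fc (per _ Lz).
  apply: closureS => _ [w [Lw pw] <-]; split; first by right; exists w.
  have [n [n0 fw _]] := per2 _ Lw pw.
  by apply: (@periodic_pointP _ _ n) => //; rewrite -iterSr iterS fw.
- exists beta => // y [Ly|[z Lz <-]] eps eps0.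
    have [w [Lw yw [k bk]]] := sens _ Ly _ eps0.
    by exists w; split => //; [left | exists k.*2; rewrite -!iter_double].
  have [d d0 fd] := continuous_distP z fc eps0.
  have m0 : 0 < Num.min d beta by rewrite lt_min d0.
  have [w [Lw]] := sens _ Lz _ m0; rewrite lt_min => /andP[zw zb] [k bk].
  exists (f w); split; [by right; exists w | exact: fd|].
  (* k is positive, since z and w are less than beta apart *)
  case: k bk => [|k bk]; first by move=> /(lt_trans zb); rewrite ltxx.
  by exists k.*2.+1; rewrite -!iterSr -doubleS -!iter_double.
- exists x; first by left.
  move=> y [Ly|[z Lz <-]]; first exact: (closureS (orb x) (dx _ Ly)).
  apply: (closureS (@orb' x)).
  exact: continuous_image_closure (dx _ Lz).
Qed.

(** * Covering relations between intervals *)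

(** The n-th iterate of f maps [u, v] over [u', v']. Only surjectivity is
    recorded, so that such relations compose and pass to subintervals. *)
Definition covers f n (u v u' v' : R) : Prop :=
  forall y, u' <= y <= v' -> exists2 x, u <= x <= v & iter n f x = y.

Lemma covers_trans f m n u v u' v' u2 v2 : covers f m u v u' v' ->
  covers f n u' v' u2 v2 -> covers f (n + m) u v u2 v2.
Proof.
move=> c1 c2 y /c2[x /c1[z zuv <-] <-].
by exists z => //; rewrite iterD.
Qed.

Lemma covers_next f n u v u' v' u2 v2 : covers f n u v u' v' ->
  covers f 1 u' v' u2 v2 -> covers f n.+1 u v u2 v2.
Proof. exact: (@covers_trans f n 1). Qed.

Lemma covers_sub f n u v u' v' u2 v2 : u' <= u2 -> v2 <= v' ->
  covers f n u v u' v' -> covers f n u v u2 v2.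
Proof.
by move=> h1 h2 c y /andP[y1 y2]; apply: c; apply/andP; split; lra.
Qed.

Lemma covers_shrink f n u v u' v' u2 v2 : u <= u2 -> v2 <= v ->
  covers f n u2 v2 u' v' -> covers f n u v u' v'.
Proof.
move=> h1 h2 c y /c[x /andP[x1 x2] xy]; exists x => //.
by apply/andP; split; lra.
Qed.

Lemma covers_image f u v u' v' : continuous f -> u <= v ->
  (exists2 x, u <= x <= v & f x = u') ->
  (exists2 x, u <= x <= v & f x = v') -> covers f 1 u v u' v'.
Proof.
move=> fc uv [x /andP[x1 x2] fx] [y /andP[y1 y2] fy] z /andP[z1 z2] /=.
have fcw a b : {within `[a, b], continuous f} by exact: continuous_subspaceT.
have [xy|/ltW yx] := leP x y.
  have [||w] := @IVT R f x y z xy; first exact: fcw.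
    by rewrite fx fy ge_min le_max z1 z2 orbT.
  rewrite in_itv /= => /andP[w1 w2] fw; exists w => //.
  by apply/andP; split; lra.
have [||w] := @IVT R f y x z yx; first exact: fcw.
  by rewrite fx fy ge_min le_max z1 z2 orbT.
rewrite in_itv /= => /andP[w1 w2] fw; exists w => //.
by apply/andP; split; lra.
Qed.

Lemma covers_self_fixed f n u v : continuous f -> u <= v ->
  covers f n u v u v -> exists2 x, u <= x <= v & iter n f x = x.
Proof.
move=> fc uv cov; pose g x := iter n f x - x.
have gc : continuous g.
  by move=> x; apply: cvgB; [exact: iter_continuous | exact: cvg_id].
have [x /andP[x1 x2] fx] := cov u ltac:(by rewrite lexx uv).
have [y /andP[y1 y2] fy] := cov v ltac:(by rewrite lexx uv).
have [|||w w12 gw] := @covers_image g u v (g x) (g y) gc uv _ _ 0.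
- by exists x => //; apply/andP.
- by exists y => //; apply/andP.
- by rewrite /g fx fy; apply/andP; split; lra.
by exists w => //; apply/eqP; rewrite -subr_eq0; apply/eqP.
Qed.

(** Bernoulli's inequality and the archimedean property. *)
Lemma pow_unbounded (l C : R) : 1 < l -> exists n, C < l ^+ n.
Proof.
move=> l1.
have bern n : 1 + n%:R * (l - 1) <= l ^+ n.
  elim: n => [|n IH]; first by rewrite mul0r addr0 expr0.
  have : 0 <= n%:R * (l - 1) by rewrite mulr_ge0// subr_ge0 ltW.
  rewrite exprS -natr1 mulrDl mul1r; move: IH; move: (n%:R * _) (l ^+ n) => m L.
  nra.
have l1' : 0 < l - 1 by rewrite subr_gt0.
exists (Num.bound (`|C| / (l - 1))).
apply: lt_le_trans (bern _).
have /archi_boundP : 0 <= `|C| / (l - 1) by rewrite divr_ge0// ltW.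
rewrite ltr_pdivrMr// => h; have := ler_norm C; lra.
Qed.

Lemma pow_small (k C eps : R) : 0 < k -> k < 1 -> 0 < eps ->
  exists n, k ^+ n * C < eps.
Proof.
move=> k0 k1 eps0; have k1' : 1 < k^-1 by rewrite invf_gt1.
have [n] := pow_unbounded (C / eps) k1'; exists n.
have kn0 : 0 < k ^+ n by rewrite exprn_gt0.
by rewrite mulrC -ltr_pdivlMr// mulrC -ltr_pdivrMr// -exprVn.
Qed.

(** Intervals of bounded length cannot be stretched forever by a factor l > 1:
    the process has to stop, at an interval satisfying Q. *)
Lemma covers_grow f C l (P Q : R -> R -> Prop) : 1 < l ->
  (forall u v, P u v -> 0 < v - u <= C) ->
  (forall u v, P u v ->
     (exists n u' v', [/\ covers f n u v u' v', P u' v' & Q u' v']) \/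
     exists n u' v', [/\ covers f n u v u' v', P u' v' &
       l * (v - u) <= v' - u']) ->
  forall u v, P u v -> exists n u' v', [/\ covers f n u v u' v', P u' v' & Q u' v'].
Proof.
move=> l1 bnd grow u v Puv.
have claim m : (exists n u' v', [/\ covers f n u v u' v', P u' v' & Q u' v']) \/
  (exists n u' v', [/\ covers f n u v u' v', P u' v' &
    l ^+ m * (v - u) <= v' - u']).
  elim: m => [|m [IH|[n [u' [v' [cov P' big]]]]]]; [|by left|].
    right; exists 0%N, u, v; split => //; last by rewrite expr0 mul1r.
    by move=> y yuv; exists y.
  have [[k [u2 [v2 [cov2 P2 Q2]]]]|[k [u2 [v2 [cov2 P2 big2]]]]] := grow _ _ P'.
    by left; exists (k + n)%N, u2, v2; split => //; exact: covers_trans cov2.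
  right; exists (k + n)%N, u2, v2; split => //; first exact: covers_trans cov2.
  rewrite exprS -mulrA; apply: le_trans big2; rewrite ler_pM2l//.
  by apply: lt_trans l1.
have /andP[uv _] := bnd _ _ Puv.
have [m] := pow_unbounded (C / (v - u)) l1.
rewrite ltr_pdivrMr// => big.
have [//|[n [u' [v' [_ /bnd/andP[_ h2] h3]]]]] := claim m; exfalso; lra.
Qed.

(** Intervals that eventually spread over either half of [lo, hi] give density
    of periodic points by the intermediate value theorem, sensitivity since two
    points far apart are reached at once, and transitivity. *)
Lemma covers_chaotic f lo h hi : continuous f -> lo < h -> h < hi ->
  (forall x, lo <= x <= hi -> lo <= f x <= hi) ->
  (forall u v, lo <= u -> u < v -> v <= hi ->
    exists n, covers f n u v h hi /\ covers f n.+1 u v lo h) ->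
  devaney_chaotic f [set` `[lo, hi]].
Proof.
move=> fc loh hhi inv cov.
have near (x eps : R) : lo <= x <= hi -> 0 < eps -> exists u v,
    [/\ lo <= u, u < v, v <= hi, (forall y, u <= y <= v -> `|x - y| < eps) &
      v <= h \/ h <= u].
  move=> /andP[lox xhi] eps0.
  have [xh|hx] := ltP x h.
    exists x, (Num.min (x + eps / 2) h); split => //.
    - by rewrite lt_min xh andbT; lra.
    - by rewrite ge_min (ltW hhi) orbT.
    - move=> y /andP[xy]; rewrite le_min => /andP[y1 _].
      by rewrite ltr_norml; apply/andP; split; lra.
    - by left; rewrite ge_min lexx orbT.
  have [xh|xh] := ltP x hi.
    exists x, (Num.min (x + eps / 2) hi); split => //.
    - by rewrite lt_min xh andbT; lra.
    - by rewrite ge_min lexx orbT.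
    - move=> y /andP[xy]; rewrite le_min => /andP[y1 _].
      by rewrite ltr_norml; apply/andP; split; lra.
    - by right.
  exists (Num.max (x - eps / 2) h), x; split => //.
  - by rewrite le_max (ltW loh) orbT.
  - by rewrite gt_max; apply/andP; split; lra.
  - move=> y /andP[+ xy]; rewrite ge_max => /andP[y1 _].
    by rewrite ltr_norml; apply/andP; split; lra.
  - by right; rewrite le_max lexx orbT.
have AE := set_itvccP lo hi.
split.
- exact: itv_closed.
- by move=> _ [x /AE xA <-]; apply/AE/inv.
- move=> x /AE xA; apply/closure_distP => eps eps0.
  have [u [v [lou uv vhi nr half]]] := near _ _ xA eps0.
  have [n [c1 c2]] := cov _ _ lou uv vhi.
  have [k k0 ck] : exists2 k, (0 < k)%N & covers f k u v u v.
    case: half => half.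
      by exists n.+1 => //; apply: covers_sub c2.
    (* one more round from [lo, h] also covers [h, hi], at a positive time *)
    have [m [c3 _]] := cov _ _ (lexx lo) loh (ltW hhi).
    by exists (m + n.+1)%N; rewrite ?addnS//; apply: (covers_sub half vhi);
      rewrite -addnS; apply: covers_trans c2 c3.
  have [y yuv fy] := covers_self_fixed fc (ltW uv) ck.
  exists y; last exact: nr.
  split; last exact: periodic_pointP fy.
  by apply/AE; move/andP: yuv => [y1 y2]; apply/andP; split; lra.
- exists ((hi - h) / 4); first by lra.
  move=> x /AE xA eps eps0.
  have [u [v [lou uv vhi nr _]]] := near _ _ xA eps0.
  have [n [c1 _]] := cov _ _ lou uv vhi.
  have [y yuv fy] := c1 h ltac:(by rewrite lexx (ltW hhi)).
  have [z zuv fz] := c1 hi ltac:(by rewrite lexx (ltW hhi)).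
  have inA w : u <= w <= v -> [set` `[lo, hi]] w.
    by move=> /andP[w1 w2]; apply/AE/andP; split; lra.
  have [far|close] := ltP ((hi - h) / 4) `|iter n f x - h|.
    by exists y; split; [exact: inA | exact: nr | exists n; rewrite fy].
  exists z; split; [exact: inA | exact: nr | exists n; rewrite fz].
  have := ler_distD (iter n f x) hi h; rewrite (distrC hi (iter n f x)).
  have := ler_norm (hi - h); lra.
- apply: transitive_dense_orbit => //; first exact: itv_closed.
    by exists lo; apply/AE; rewrite lexx; lra.
  move=> x y eps /AE xA /AE /andP[loy yhi] eps0.
  have [u [v [lou uv vhi nr _]]] := near _ _ xA eps0.
  have [n [c1 c2]] := cov _ _ lou uv vhi.
  have [k [z zuv fz]] : exists k, exists2 z, u <= z <= v & iter k f z = y.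
    have [yh|hy] := leP y h; [exists n.+1; apply: c2 | exists n; apply: c1].
      by rewrite loy.
    by rewrite yhi (ltW hy).
  exists z; split; [|exact: nr|by exists k; rewrite fz subrr normr0].
  by apply/AE; move/andP: zuv => [z1 z2]; apply/andP; split; lra.
Qed.

End line_dynamics.

(** * Skew tent maps *)

Section tent_maps.
Context {R : realType}.
Implicit Types (e r p a b h x : R).

(** As a minimum of two affine functions the map is continuous on the whole line;
    r is the turning point and p the peak value. *)
Definition tent r p a b x : R := Num.min (p - a * (r - x)) (p - b * (x - r)).

(** The graph of the tent map rises from the fixed point (e, e) with slope a to
    the peak (r, p), then falls with slope - b. *)
Record tent_data e r p a b : Prop := TentData {
  tent_e_lt_r : e < r;
  tent_a_gt1 : 1 < a;
  tent_b_gt0 : 0 < b;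
  tent_peak : p = e + a * (r - e)
}.

Section one_tent.
Variables (e r p a b : R).
Hypothesis data : tent_data e r p a b.
Let F := tent r p a b.

Lemma tent_r_lt_p : r < p.
Proof.
have [er a1 b0 pE] := data.
rewrite pE; nra.
Qed.

Lemma tent_up x : x <= r -> F x = p - a * (r - x).
Proof.
have [er a1 b0 pE] := data.
by move=> xr; rewrite /F /tent min_l//; nra.
Qed.

Lemma tent_down x : r <= x -> F x = p - b * (x - r).
Proof.
have [er a1 b0 pE] := data.
by move=> rx; rewrite /F /tent min_r//; nra.
Qed.

Lemma tent_le_peak x : F x <= p.
Proof.
have [er a1 b0 pE] := data.
have [xr|/ltW rx] := leP x r; first by rewrite tent_up//; nra.
by rewrite tent_down//; nra.
Qed.

Lemma tent_upE x : x <= r -> F x = e + a * (x - e).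
Proof.
have [_ _ _ pE] := data.
by move=> xr; rewrite tent_up// pE; ring.
Qed.

Lemma tent_peakE : F r = p.
Proof.
by rewrite tent_up// subrr mulr0 subr0.
Qed.

Lemma tent_continuous : continuous F.
Proof.
apply: min_fun_continuous => x; apply: cvgB; try exact: cvg_cst.
  apply: cvgM; first exact: cvg_cst.
  by apply: cvgB; [exact: cvg_cst | exact: cvg_id].
apply: cvgM; first exact: cvg_cst.
by apply: cvgB; [exact: cvg_id | exact: cvg_cst].
Qed.

Lemma tent_down_fixed : exists2 h, r < h < p & p - b * (h - r) = h.
Proof.
have [er a1 b0 pE] := data.
have b10 : 1 + b != 0 by apply: lt0r_neq0; lra.
exists ((p + b * r) / (1 + b)); last by field.
have rp := tent_r_lt_p.
by rewrite ltr_pdivlMr ?ltr_pdivrMr; [apply/andP; split; nra | lra | lra].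
Qed.

(** Left of r the distance to e is multiplied by a > 1, so that no orbit
    starting above e stays there. *)
Lemma tent_reach s x : s <= r -> e < x -> x <= p ->
  exists n, s <= iter n F x <= p.
Proof.
have a1 := tent_a_gt1 data.
move=> sr ex xp; apply: contrapT => no.
have lep n : iter n F x <= p.
  by case: n => //= n; exact: tent_le_peak.
have lts n : iter n F x < s.
  by rewrite ltNge; apply/negP => h; apply: no; exists n; rewrite h lep.
have E n : iter n F x = e + a ^+ n * (x - e).
  elim: n => [|n IH]; first by rewrite expr0 mul1r addrC subrK.
  rewrite iterS tent_upE; last by apply: ltW; apply: lt_le_trans (lts n) sr.
  by rewrite IH exprS; ring.
have [n] := pow_unbounded ((r - e) / (x - e)) a1.
rewrite ltr_pdivrMr ?subr_gt0// => big.
by have := lts n; rewrite E; lra.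
Qed.

End one_tent.

Lemma tent_invariant e r p a b : tent_data e r p a b -> e <= tent r p a b p ->
  invariant_set (tent r p a b) [set` `[e, p]].
Proof.
move=> D; have rp := tent_r_lt_p D; have er := tent_e_lt_r D.
have [a1 b0] := (tent_a_gt1 D, tent_b_gt0 D).
rewrite (tent_down D (ltW rp)) => Fp _ [x /set_itvccP/andP[ex xp] <-].
apply/set_itvccP; rewrite (tent_le_peak D) andbT.
have [xr|/ltW rx] := leP x r; first by rewrite (tent_upE D xr); nra.
by rewrite (tent_down D rx); nra.
Qed.

(** The situation in which the interval between the images of the peak value and of
    the turning point is invariant and absorbs all points of (e, p]. *)
Record tent_core e r p a b h : Prop := TentCore {
  core_tent : tent_data e r p a b;
  core_b_gt1 : 1 < b;
  core_r_lt_h : r < h;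
  core_h_lt_p : h < p;
  core_fixed : p - b * (h - r) = h;
  core_e_lt : e < p - b * (p - r)
}.

Section expanding_tent.
Variables (e r p a b h : R).
Hypothesis core : tent_core e r p a b h.
Let F := tent r p a b.
Let data := core_tent core.

Lemma tent_image_peak : F p = p - b * (p - r).
Proof.
exact/(tent_down data)/ltW/(tent_r_lt_p data).
Qed.

Lemma tent_fixedE : F h = h.
Proof.
have [[er a1 b0 pE] b1 rh hp hE eFp] := core.
by rewrite /F (tent_down data) ?ltW// hE.
Qed.

Lemma tent_Fp_lt_r : F p < r.
Proof.
have [[er a1 b0 pE] b1 rh hp hE eFp] := core.
have rp := tent_r_lt_p data.
rewrite tent_image_peak; nra.
Qed.

Lemma tent_le_fixed x : F p <= x -> x <= h -> F p <= F x.
Proof.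
have [[er a1 b0 pE] b1 rh hp hE eFp] := core.
have rp := tent_r_lt_p data.
rewrite tent_image_peak => px xh; rewrite /F.
have [xr|/ltW rx] := leP x r; first by rewrite (tent_upE data)//; nra.
by rewrite (tent_down data)//; nra.
Qed.

Lemma tent_core_invariant x : F p <= x <= p -> F p <= F x <= p.
Proof.
have [[er a1 b0 pE] b1 rh hp hE eFp] := core.
have rp := tent_r_lt_p data.
move=> /andP[px xp]; rewrite (tent_le_peak data) andbT.
have [xh|hx] := leP x h; first exact: tent_le_fixed.
by rewrite tent_image_peak /F (tent_down data); [nra | lra].
Qed.

Lemma tent_reach_core x : e < x -> x <= p ->
  exists n0, forall n, (n0 <= n)%N -> F p <= iter n F x <= p.
Proof.
move=> ex xp; have [n0 Fn0] := tent_reach data (ltW tent_Fp_lt_r) ex xp.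
exists n0 => n /subnK <-; elim: (n - n0)%N => // k IH.
by rewrite addSn iterS; apply: tent_core_invariant.
Qed.

(** * The core of a tent map that does not renormalize *)

Section no_renormalization.
Hypothesis FFph : F (F p) <= h.

(** In terms of d = h - r, one has p - r = (1 + b) d and p - h = b d, so that
    F (F p) <= h reads b <= a (b - 1) (1 + b). *)
Lemma tent_slope_bound : a + b <= a * b ^+ 2.
Proof.
have [[er a1 b0 pE] b1 rh hp hE eFp] := core.
have rp := tent_r_lt_p data.
have E : F (F p) = p - a * (r - F p).
  by rewrite {1}/F (tent_up data)// ltW// tent_Fp_lt_r.
move: FFph; rewrite E tent_image_peak => hyp.
have prE : p - r = (1 + b) * (h - r) by lra.
have hyp' : p - a * (b - 1) * (p - r) <= h by lra.
have : b * (h - r) <= a * (b - 1) * (1 + b) * (h - r).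
  by rewrite -[X in _ <= X]mulrA -prE; lra.
rewrite ler_pM2r ?subr_gt0//; rewrite expr2; lra.
Qed.

Let cont : continuous F := @tent_continuous r p a b.

Lemma covers_up u v : u <= v -> v <= r -> covers F 1 u v (F u) (F v).
Proof.
move=> uv vr; apply: covers_image => //.
  by exists u => //; rewrite lexx.
by exists v => //; rewrite lexx uv.
Qed.

Lemma covers_down u v : u <= v -> r <= u -> covers F 1 u v (F v) (F u).
Proof.
move=> uv vr; apply: covers_image => //.
  by exists v => //; rewrite lexx uv.
by exists u => //; rewrite lexx uv.
Qed.

Lemma covers_peak x u v : u <= r <= v -> u <= x <= v -> covers F 1 u v (F x) p.
Proof.
move=> /andP[ur rv] uxv; apply: covers_image => //.
- by apply: le_trans rv.
- by exists x.
- by exists r; [rewrite ur | rewrite /F (tent_peakE data)].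
Qed.

(** An interval around r is folded: of its two images only the longer one counts.
    If this image does not contain h, it lies on the falling side, where the next
    step makes up for the fold by the bound on the slopes; the image then reaches
    down to F p. Either it contains r, and the image after that contains both
    F (F p) <= h and p; or it lies on the rising side, and one more step gains the
    factor a. *)
Lemma covers_fixed u v : [/\ F p <= u, u < v & v <= p] ->
  exists n u' v', [/\ covers F n u v u' v', [/\ F p <= u', u' < v' & v' <= p] &
    u' <= h <= v'].
Proof.
have [[er a1 b0 pE] b1 rh hp hE eFp] := core.
have rp := tent_r_lt_p data.
have [l [l1 la lb]] : exists l, [/\ 1 < l, l <= a & l <= b].
  by exists (Num.min a b); rewrite lt_min a1 b1 !ge_min !lexx orbT.
apply: (@covers_grow _ F (p - F p) l (fun u v => [/\ F p <= u, u < v & v <= p])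
  (fun u v => is_true (u <= h <= v)) l1) => {}u {}v [pu uv vp].
  by apply/andP; split; lra.
have inside x : F p <= x <= p -> F p <= F x <= p by exact: tent_core_invariant.
have /andP[pFu Fup] : F p <= F u <= p by apply: inside; lra.
have /andP[pFv Fvp] : F p <= F v <= p by apply: inside; lra.
have [vr|rv] := leP v r.
  have FuE : F u = e + a * (u - e) by apply: (tent_upE data); lra.
  have FvE : F v = e + a * (v - e) by apply: (tent_upE data).
  right; exists 1%N, (F u), (F v); split; [exact: covers_up (ltW uv) vr| |].
    by split => //; rewrite FuE FvE; nra.
  by rewrite FuE FvE; nra.
have [ru|ur] := leP r u.
  have FuE : F u = p - b * (u - r) by apply: (tent_down data).
  have FvE : F v = p - b * (v - r) by apply: (tent_down data); lra.
  right; exists 1%N, (F v), (F u); split; [exact: covers_down (ltW uv) ru| |].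
    by split => //; rewrite FuE FvE; nra.
  by rewrite FuE FvE; nra.
(* x is the endpoint of u, v whose image is farther from p *)
have [x xuv xbig] : exists2 x, u <= x <= v &
    a * b * (v - u) <= (a + b) * (p - F x).
  have [le|/ltW le] := leP (a * (r - u)) (b * (v - r)).
    exists v; first by rewrite lexx ltW.
    by rewrite /F (tent_down data); [nra | lra].
  exists u; first by rewrite lexx ltW.
  by rewrite /F (tent_up data); [nra | lra].
have cov1 : covers F 1 u v (F x) p by apply: covers_peak => //; rewrite !ltW.
have /andP[pFx Fxp] : F p <= F x <= p.
  by apply: inside; move/andP: xuv => [x1 x2]; apply/andP; split; lra.
have Fxp' : F x < p.
  suff : 0 < p - F x by lra.
  have : 0 < a * b * (v - u) by rewrite !mulr_gt0//; lra.
  nra.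
have [Fxh|hFx] := leP (F x) h.
  by left; exists 1%N, (F x), p; split; rewrite // Fxh ltW.
have stretch : v - u <= b * (p - F x).
  have sb := tent_slope_bound.
  have : a * b * (v - u) <= a * b * (b * (p - F x)).
    apply: le_trans xbig _; have -> : a * b * (b * (p - F x)) = a * b ^+ 2 * (p - F x).
      by ring.
    by rewrite ler_wpM2r// subr_ge0.
  by rewrite ler_pM2l// mulr_gt0//; lra.
have FFxE : F (F x) = p - b * (F x - r) by apply: (tent_down data); lra.
have pE' := tent_image_peak.
have cov2 : covers F 2 u v (F p) (F (F x)).
  by apply: (covers_next cov1); apply: covers_down; lra.
have lt2 : F p < F (F x) by rewrite FFxE pE'; nra.
have [pFFp FFpp] : F p <= F (F p) /\ F (F p) <= p.
  by apply/andP; apply: inside; rewrite lexx pE'; nra.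
have [rFFx|FFxr] := leP r (F (F x)).
  left; exists 3%N, (F (F p)), p; split; last by rewrite FFph ltW.
    apply: (covers_next cov2); apply: covers_peak; last by rewrite lexx ltW.
    by rewrite rFFx ltW// tent_Fp_lt_r.
  by split => //; exact: le_lt_trans FFph hp.
right; exists 3%N, (F (F p)), (F (F (F x))).
have E3 : F (F (F x)) - F (F p) = a * (b * (p - F x)).
  have upF y : y <= r -> F y = e + a * (y - e) by exact: tent_upE.
  rewrite (upF (F (F x))) ?ltW// (upF (F p)) ?ltW ?tent_Fp_lt_r//.
  by rewrite FFxE pE'; ring.
have lt3 : l * (v - u) <= F (F (F x)) - F (F p) by rewrite E3; nra.
have lt30 : 0 < l * (v - u) by rewrite mulr_gt0//; lra.
split => //; last by split; [|lra|exact: (tent_le_peak data)].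
by apply: (covers_next cov2); apply: covers_up; lra.
Qed.

(** Once h is inside, it remains in all images: the interval keeps growing by the
    factor b until it reaches r, and then covers [r, h]. *)
Lemma covers_halves u v : F p <= u -> u < v -> v <= p ->
  exists n, covers F n u v h p /\ covers F n.+1 u v (F p) h.
Proof.
have [[er a1 b0 pE] b1 rh hp hE eFp] := core.
have rp := tent_r_lt_p data.
have Fh := tent_fixedE.
move=> pu uv vp.
have [n1 [u1 [v1 [cov1 [pu1 uv1 vp1] uhv1]]]] := covers_fixed (And3 pu uv vp).
have [n2 [u2 [v2 [cov2 _ /andP[ur hv]]]]] : exists n w z, [/\ covers F n u1 v1 w z,
    [/\ F p <= w, w < z, z <= p & w <= h <= z] & (w <= r) && (h <= z)].
  apply: (@covers_grow _ F (p - F p) b (fun w z =>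
    [/\ F p <= w, w < z, z <= p & w <= h <= z])
    (fun w z => is_true ((w <= r) && (h <= z))) b1) => // w z [pw wz zp /andP[wh hz]].
    by apply/andP; split; lra.
  have [wr|rw] := leP w r; [left | right].
    exists 0%N, w, z; split; rewrite ?wr ?wh //.
    by move=> y wyz; exists y.
  have Fw : F w = p - b * (w - r) by apply: (tent_down data); lra.
  have Fz : F z = p - b * (z - r) by apply: (tent_down data); lra.
  have pE' := tent_image_peak.
  exists 1%N, (F z), (F w); split.
  - by apply: covers_down; lra.
  - split; [by rewrite pE' Fz; nra | by rewrite Fz Fw; nra |
      exact: (tent_le_peak data)|by rewrite Fz Fw; apply/andP; split; nra].
  - by rewrite Fz Fw; lra.
have cov3 : covers F 1 u2 v2 h p.
  rewrite -{1}Fh; apply: (@covers_shrink _ F 1 u2 v2 (F h) p r h) => //.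
  apply: covers_peak; rewrite !lexx ltW//.
have cov4 := covers_next (covers_trans cov1 cov2) cov3.
exists (n2 + n1).+1%N; split => //; apply: (covers_next cov4).
by rewrite -{2}Fh; apply: covers_down; lra.
Qed.

Lemma tent_core_chaotic : devaney_chaotic F [set` `[F p, p]].
Proof.
have [[er a1 b0 pE] b1 rh hp hE eFp] := core.
apply: (@covers_chaotic _ F (F p) h p) => //.
- exact: lt_trans tent_Fp_lt_r rh.
- exact: tent_core_invariant.
- exact: covers_halves.
Qed.

End no_renormalization.
End expanding_tent.
End tent_maps.

(** * Renormalization *)

Section renormalization.
Context {R : realType}.
Implicit Types (e r p a b h x : R) (f : R -> R).

Definition cells N (u v : nat -> R) : set R :=
  [set x | exists2 i, (i < 2 ^ N)%N & u i <= x <= v i].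

(** The data are indexed by natural numbers, since renormalization concatenates
    cells and shifts the orbits: O j for the second iterate becomes O (j + 1).
    For that reason attraction is asked of all points of (e, p], with all the
    orbits avoided; by the last field, a point of the core outside orbit 0 never
    meets that orbit. *)
Record cascade f e p N (u v : nat -> R) (O : nat -> set R) : Prop := Cascade {
  cascade_lt : forall i, (i < 2 ^ N)%N -> u i < v i;
  cascade_disjoint : forall i j x, (i < 2 ^ N)%N -> (j < 2 ^ N)%N ->
    u i <= x <= v i -> u j <= x <= v j -> i = j;
  cascade_sub : cells N u v `<=` [set` `[f p, p]];
  cascade_chaotic : devaney_chaotic f (cells N u v);
  cascade_orbit_sub : forall j, (j < N)%N ->
    O j `<=` [set` `[f p, p]] `\` cells N u v;
  cascade_orbit : forall j, (j < N)%N -> periodic_orbit f (2 ^ j) (O j);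
  cascade_unstable : forall j, (j < N)%N -> ~ stable_set [set` `[e, p]] f (O j);
  cascade_attract : forall x, e < x -> x <= p ->
    (forall j n, (j < N)%N -> ~ O j (iter n f x)) ->
    exists n, cells N u v (iter n f x);
  cascade_fixed : forall x n, (0 < N)%N -> f p <= x <= p ->
    O 0%N (iter n f x) -> O 0%N x
}.

(** The point on the falling side that is mapped to the turning point. *)
Definition renorm_r r p b : R := r + (p - r) / b.

Lemma renorm_tent_core e r p a b h : tent_core e r p a b h ->
  h < tent r p a b (tent r p a b p) ->
  exists h', tent_core h (renorm_r r p b) p (b ^+ 2) (a * b) h'.
Proof.
move=> C hFF; have Fpr := tent_Fp_lt_r C.
have [[er a1 b0 pE] b1 rh hp hE eFp] := C.
have rp := tent_r_lt_p (core_tent C).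
move: hFF; rewrite (tent_up (core_tent C) (ltW Fpr)) (tent_image_peak C) => hFF.
have b0' : b != 0 by apply: lt0r_neq0.
have [q qE] : exists q, b * (q - r) = p - r.
  by exists (renorm_r r p b); rewrite /renorm_r; field.
have <- : q = renorm_r r p b by rewrite /renorm_r -qE; field.
have D : tent_data h q p (b ^+ 2) (a * b).
  split; [by nra|by nra|by nra|].
  have -> : b ^+ 2 * (q - h) = b * (b * (q - r)) - b * (b * (h - r)) by ring.
  have bhr : b * (h - r) = p - h by lra.
  by rewrite qE bhr; lra.
have [h' /andP[qh' h'p] h'E] := tent_down_fixed D.
exists h'; split => //; first by nra.
have -> : a * b * (p - q) = a * (b * (p - r)) - a * (b * (q - r)) by ring.
by rewrite qE; nra.
Qed.

(** On the falling side, two steps of the tent map form a tent map again: the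
    falling slope is met twice below the new turning point, and once together
    with the rising slope above it. *)
Lemma renorm_tent_eq e r p a b h x : tent_core e r p a b h -> h <= x -> x <= p ->
  tent r p a b (tent r p a b x) = tent (renorm_r r p b) p (b ^+ 2) (a * b) x.
Proof.
move=> C hx xp; have [[er a1 b0 pE] b1 rh hp hE eFp] := C.
have rp := tent_r_lt_p (core_tent C).
have b0' : b != 0 by apply: lt0r_neq0.
have [q qE] : exists q, b * (q - r) = p - r.
  by exists (renorm_r r p b); rewrite /renorm_r; field.
have <- : q = renorm_r r p b by rewrite /renorm_r -qE; field.
have FxE : tent r p a b x = p - b * (x - r) by apply: (tent_down (core_tent C)); lra.
have b20 : 0 < b ^+ 2 by nra.
have ab0 : 0 < a * b by nra.
have [xq|/ltW qx] := leP x q.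
  rewrite FxE (tent_down (core_tent C)); last by nra.
  rewrite /tent min_l; last by nra.
  have -> : b ^+ 2 * (q - x) = b * (b * (q - r)) - b * (b * (x - r)) by ring.
  by rewrite qE; ring.
rewrite FxE (tent_up (core_tent C)); last by nra.
rewrite /tent min_r; last by nra.
have -> : a * b * (x - q) = a * (b * (x - r)) - a * (b * (q - r)) by ring.
by rewrite qE; ring.
Qed.

Section doubling.
Variables (e r p a b h : R).
Hypothesis core : tent_core e r p a b h.
Let f := tent r p a b.
Let g := tent (renorm_r r p b) p (b ^+ 2) (a * b).
Hypothesis renormalizable : h < f (f p).

Let rp : r < p := tent_r_lt_p (core_tent core).
Let rh := core_r_lt_h core.
Let hp := core_h_lt_p core.

Lemma renorm_peak : g p = f (f p).
Proof. by rewrite /f (renorm_tent_eq core)// ltW. Qed.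

Lemma renorm_invariant : invariant_set g [set` `[h, p]].
Proof.
have [h' C'] := renorm_tent_core core renormalizable.
by apply: (tent_invariant (core_tent C')); rewrite -/g renorm_peak ltW.
Qed.

Lemma renorm_iter n x : h <= x <= p -> iter n g x = iter n.*2 f x.
Proof.
move=> xhp; rewrite -iter_double; symmetry.
apply: (eq_iter_in renorm_invariant); last exact/set_itvccP.
by move=> y /set_mem/set_itvccP/andP[hy yp]; rewrite /= /f (renorm_tent_eq core).
Qed.

Lemma renorm_iter_inside n x : h <= x <= p -> h <= iter n g x <= p.
Proof.
by move=> xhp; apply/set_itvccP/(invariant_iter _ renorm_invariant)/set_itvccP.
Qed.

Lemma tent_down_above x : h <= x -> f x = p - b * (x - r).
Proof.
by move=> hx; apply: (tent_down (core_tent core)); apply: le_trans hx; exact: ltW.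
Qed.

Lemma tent_above_fixed x : h < x -> f x < h.
Proof.
have [_ b1 rh' _ hE _] := core.
by move=> hx; rewrite tent_down_above ?ltW//; nra.
Qed.

Lemma tent_below_fixed x : f p <= x -> x < h -> h < f x.
Proof.
have [[er a1 b0 pE] b1 rh' hp' hE eFp] := core.
move=> px xh; have [xr|/ltW rx] := leP x r; last first.
  by rewrite /f (tent_down (core_tent core))//; nra.
apply: lt_le_trans renormalizable _.
rewrite /f (tent_up (core_tent core) xr) -/f.
rewrite {1}/f (tent_up (core_tent core)); last exact: le_trans px xr.
by rewrite -/f; nra.
Qed.

(** As f exchanges the two sides of h in its core, only h is ever mapped to h. *)
Lemma tent_fixed_preimage x n : f p <= x <= p -> iter n f x = h -> x = h.
Proof.
elim: n x => //= n IH x xp; rewrite -iterS iterSr => /IH.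
move=> /(_ (tent_core_invariant core xp)) fx.
have [xh|hx|//] := ltgtP x h.
  by have := tent_below_fixed (proj1 (andP xp)) xh; rewrite fx ltxx.
by have := tent_above_fixed hx; rewrite fx ltxx.
Qed.

Variables (N : nat) (u v : nat -> R) (O : nat -> set R).
Hypothesis casc : cascade g h p N u v O.

(** The second half of the cells consists of the images of the first half; f
    reverses order above h, so that the image of [u, v] is [f v, f u]. *)
Definition double_u i := if (i < 2 ^ N)%N then u i else f (v (i - 2 ^ N)%N).
Definition double_v i := if (i < 2 ^ N)%N then v i else f (u (i - 2 ^ N)%N).
Definition double_orbits j : set R :=
  if j is i.+1 then O i `|` f @` O i else [set h].

Let L := cells N u v.

Lemma renorm_core_above x : f (f p) <= x <= p -> h < x <= p.
Proof. by move=> /andP[px ->]; rewrite andbT; apply: lt_le_trans px. Qed.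

Lemma cells_above x : L x -> h < x <= p.
Proof.
move=> /(cascade_sub casc)/set_itvccP; rewrite renorm_peak; exact: renorm_core_above.
Qed.

Lemma cell_bounds i : (i < 2 ^ N)%N -> h < u i /\ v i <= p.
Proof.
move=> iN; have uv := cascade_lt casc iN.
have /andP[h1 _] : h < u i <= p by apply: cells_above; exists i; rewrite // lexx ltW.
have /andP[_ h2] : h < v i <= p by apply: cells_above; exists i; rewrite // lexx ltW.
by [].
Qed.

Lemma orbits_above j x : (j < N)%N -> O j x -> h < x <= p.
Proof.
move=> jN /(cascade_orbit_sub casc jN)[/set_itvccP]; rewrite renorm_peak => xp _.
exact: renorm_core_above.
Qed.

Lemma tent_image_cell y z x : h <= y -> y <= z ->
  (f z <= x <= f y) <-> exists2 w, y <= w <= z & f w = x.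
Proof.
have [[er a1 b0 pE] b1 rh' hp' hE eFp] := core.
move=> hy yz; rewrite !tent_down_above//; last by lra.
split=> [/andP[x1 x2] | [w /andP[yw wz] <-]]; last first.
  by rewrite tent_down_above; [apply/andP; split; nra | lra].
have b0' : b != 0 by apply: lt0r_neq0.
have [w wE] : exists w, b * (w - r) = p - x.
  by exists (r + (p - x) / b); field.
have yw : y <= w by nra.
exists w; first by rewrite yw; nra.
by rewrite tent_down_above; [rewrite wE; lra | lra].
Qed.

Lemma upper_cell_index i : (i < 2 ^ N.+1)%N -> ~~ (i < 2 ^ N)%N -> (i - 2 ^ N < 2 ^ N)%N.
Proof. by rewrite -leqNgt expnS mul2n -addnn => h1 h2; rewrite ltn_subLR. Qed.

Lemma double_cells : cells N.+1 double_u double_v = L `|` f @` L.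
Proof.
have lt1 : (2 ^ N < 2 ^ N.+1)%N by rewrite ltn_exp2l.
apply/seteqP; split=> x.
  case=> i iN; rewrite /double_u /double_v; case: ifPn => [iN1 | iN1] ix.
    by left; exists i.
  have iN2 := upper_cell_index iN iN1; have [hu _] := cell_bounds iN2.
  right; have [w wi <-] := (tent_image_cell x (ltW hu) (ltW (cascade_lt casc iN2))).1 ix.
  by exists w => //; exists (i - 2 ^ N)%N.
case=> [[i iN ix] | [y [i iN iy] <-]].
  by exists i; [exact: ltn_trans lt1 | rewrite /double_u /double_v iN].
exists (i + 2 ^ N)%N; first by rewrite expnS mul2n -addnn ltn_add2r.
have [hu _] := cell_bounds iN.
rewrite /double_u /double_v ltnNge leq_addl /= addnK.
by apply/(tent_image_cell (f y) (ltW hu) (ltW (cascade_lt casc iN))); exists y.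
Qed.

Lemma tent_inj_above x y : h <= x -> h <= y -> f x = f y -> x = y.
Proof.
have [[er a1 b0 pE] b1 rh' hp' hE eFp] := core.
move=> hx hy; rewrite !tent_down_above// => E; have : b * (x - y) = 0 by lra.
by move=> /eqP; rewrite mulf_eq0 gt_eqF//= subr_eq0 => /eqP.
Qed.

Lemma tent_above_image x : h <= x <= p -> f p <= f x <= h.
Proof.
have [[er a1 b0 pE] b1 rh' hp' hE eFp] := core.
move=> /andP[hx xp]; rewrite (tent_down_above hx) (tent_down_above (ltW hp')).
by apply/andP; split; nra.
Qed.

Lemma double_disjoint i j x : (i < 2 ^ N.+1)%N -> (j < 2 ^ N.+1)%N ->
  double_u i <= x <= double_v i -> double_u j <= x <= double_v j -> i = j.
Proof.
move=> iN jN; rewrite /double_u /double_v.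
case: ifPn => iN1; case: ifPn => jN1.
- exact: (cascade_disjoint casc).
- have jN2 := upper_cell_index jN jN1; have [hu _] := cell_bounds jN2.
  move=> ix /(tent_image_cell x (ltW hu) (ltW (cascade_lt casc jN2)))[w /andP[uw _] wx].
  have /andP[hx _] : h < x <= p by apply: cells_above; exists i.
  have : f w < h by apply: tent_above_fixed; apply: lt_le_trans uw.
  by rewrite wx => xh; have := lt_trans xh hx; rewrite ltxx.
- have iN2 := upper_cell_index iN iN1; have [hu _] := cell_bounds iN2.
  move=> /(tent_image_cell x (ltW hu) (ltW (cascade_lt casc iN2)))[w /andP[uw _] wx] jx.
  have /andP[hx _] : h < x <= p by apply: cells_above; exists j.
  have : f w < h by apply: tent_above_fixed; apply: lt_le_trans uw.
  by rewrite wx => xh; have := lt_trans xh hx; rewrite ltxx.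
have iN2 := upper_cell_index iN iN1; have [hu _] := cell_bounds iN2.
have jN2 := upper_cell_index jN jN1; have [hu' _] := cell_bounds jN2.
move=> /(tent_image_cell x (ltW hu) (ltW (cascade_lt casc iN2)))[w wi wx].
move=> /(tent_image_cell x (ltW hu') (ltW (cascade_lt casc jN2)))[w' wj wx'].
have ww' : w = w'.
  apply: tent_inj_above; rewrite ?wx ?wx'//.
    by apply: le_trans (proj1 (andP wi)); exact: ltW.
  by apply: le_trans (proj1 (andP wj)); exact: ltW.
have := cascade_disjoint casc iN2 jN2 wi; rewrite ww' => /(_ wj).
rewrite -leqNgt in iN1; rewrite -leqNgt in jN1.
by move=> E; rewrite -(subnK iN1) E subnK.
Qed.

Lemma tent_Fp_lt_fixed : f p < h.
Proof. by apply: lt_trans rh; apply: tent_Fp_lt_r core. Qed.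

Lemma double_chaotic : devaney_chaotic f (L `|` f @` L).
Proof.
have chaos := cascade_chaotic casc.
have [clL invL _ _ _] := chaos.
apply: devaney_chaotic_double; first exact: tent_continuous.
  apply: (subclosed_compact clL (@segment_compact _ h p)).
  by move=> x /cells_above/andP[hx xp]; apply/set_itvccP; rewrite xp ltW.
apply: eq_devaney_chaotic chaos => // x /set_mem/cells_above/andP[hx xp].
by rewrite /= /f (renorm_tent_eq core)// ltW.
Qed.

Lemma double_orbit_sub j : (j < N.+1)%N ->
  double_orbits j `<=` [set` `[f p, p]] `\` (L `|` f @` L).
Proof.
have fph := tent_Fp_lt_fixed.
have hA w : L w -> h < w by move=> /cells_above/andP[].
case: j => [_ _ ->|j jN] /=.
  split; first by apply/set_itvccP; rewrite !ltW.
  case=> [/hA|[w /hA/tent_above_fixed + wh]]; first by rewrite ltxx.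
  by rewrite wh ltxx.
have OL w : O j w -> ~ L w by move=> /(cascade_orbit_sub casc jN)[].
move=> x [Ox|[y Oy <-]].
  have /andP[hx xp] := orbits_above jN Ox; split.
    by apply/set_itvccP; rewrite xp ltW//; apply: lt_trans hx.
  case=> [|[w /hA/tent_above_fixed + wx]]; first exact: OL.
  by rewrite wx => /(lt_trans hx); rewrite ltxx.
have /andP[hy yp] := orbits_above jN Oy.
have /andP[h1 h2] : f p <= f y <= h by apply: tent_above_image; rewrite yp ltW.
split; first by apply/set_itvccP; rewrite h1 (le_trans h2)// ltW.
case=> [/hA|[w Lw wy]]; first by rewrite ltNge h2.
apply: OL Oy _; rewrite -(@tent_inj_above w y)//; last exact: ltW.
by apply/ltW/hA.
Qed.

(** The orbit alternates between the two sides of h, so that a return can only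
    take place at an even time. *)
Lemma double_orbit j : (j < N.+1)%N -> periodic_orbit f (2 ^ j) (double_orbits j).
Proof.
case: j => [_|j jN] /=.
  have fh : f h = h := tent_fixedE core.
  exists h.
    by split => // m /andP[m0]; rewrite expn0 ltnNge m0.
  apply/seteqP; split=> [x ->|_ [n _ <-]]; first by exists 0%N.
  by elim: n => //= n ->; rewrite fh.
have [x [_ gx gmin] OE] := cascade_orbit casc jN.
have Ox : O j x by rewrite OE; exists 0%N.
have /andP[hx xp] := orbits_above jN Ox.
have xhp : h <= x <= p by rewrite xp ltW.
have above n : h < iter n g x by have /andP[] : h < iter n g x <= p
  by apply: (orbits_above jN); rewrite OE; exists n.
have odd_iter n : iter n.*2.+1 f x = f (iter n g x) by rewrite iterS renorm_iter.
exists x.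
  split; [by rewrite expn_gt0|by rewrite expnS mul2n -renorm_iter|].
  move=> m /andP[m0 mN]; rewrite -(odd_double_half m) in m0 mN *.
  case: (odd m) => /= in m0 mN *.
    rewrite add0n -renorm_iter// => fx; have := tent_above_fixed (above m./2).
    by rewrite fx => /(lt_trans hx); rewrite ltxx.
  rewrite ?add0n -renorm_iter//; apply: gmin.
  rewrite ?add0n double_gt0 in m0; rewrite m0 /=.
  by rewrite ?add0n expnS mul2n ltn_double in mN.
rewrite OE; apply/seteqP; split=> [y|_ [n _ <-]].
  case=> [[n _ <-]|[_ [n _ <-] <-]].
    by exists n.*2 => //; rewrite renorm_iter.
  by exists n.*2.+1 => //; rewrite odd_iter.
rewrite -(odd_double_half n); case: (odd n).
  by right; exists (iter n./2 g x); [exists n./2 | rewrite ?add1n odd_iter].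
by left; exists n./2 => //; rewrite add0n renorm_iter.
Qed.

(** Orbits starting just above h are driven into the core of g, at a positive
    distance from h; the other orbits inherit instability from g. *)
Lemma double_unstable j : (j < N.+1)%N ->
  ~ stable_set [set` `[e, p]] f (double_orbits j).
Proof.
have eh : e < h by have [[er _ _ _] _ rh' _ _ _] := core; exact: lt_trans rh'.
case: j => [_|j jN] /= stab.
  have [||V [oV Vh VU]] := stab [set x | x < f (f p)].
  - exact: open_lt.
  - by move=> _ ->.
  have /nbhs_ballP[eps /= eps0 sub] := open_nbhs_nbhs (conj oV (Vh _ (erefl h))).
  pose x := Num.min p (h + eps / 2).
  have hx : h < x by rewrite lt_min hp; lra.
  have xp : x <= p by rewrite ge_min lexx.
  have Vx : V x.
    apply: sub; rewrite /ball /= ltr_norml.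
    have : x <= h + eps / 2 by rewrite ge_min lexx orbT.
    by move=> h1; apply/andP; split; lra.
  have [h' C'] := renorm_tent_core core renormalizable.
  have [n /(_ n (leqnn n)) /andP[low _]] := tent_reach_core C' hx xp.
  have xhp : h <= x <= p by rewrite xp ltW.
  have up : iter n.*2 f x < f (f p).
    apply: (VU x Vx) => //; apply/set_itvccP; rewrite xp andbT.
    by apply: ltW; apply: lt_trans hx.
  move: low; rewrite -/g renorm_peak (renorm_iter n xhp) => low.
  by have := le_lt_trans low up; rewrite ltxx.
apply: (cascade_unstable casc jN) => U oU OU.
have [||V [oV OV VU]] := stab ((U `&` [set x | h < x]) `|` [set x | x < h]).
- by apply: openU; [apply: openI => //; exact: open_gt | exact: open_lt].
- move=> x [Ox|[y Oy <-]].
    by left; split; [exact: OU | have /andP[] := orbits_above jN Ox].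
  by right; apply: tent_above_fixed; have /andP[] := orbits_above jN Oy.
exists V; split => //; first by move=> x Ox; apply: OV; left.
move=> x Vx /set_itvccP xhp n.
have /andP[hn _] := renorm_iter_inside n xhp.
have [|[//]|] := VU x Vx _ n.*2; last 2 first.
- by rewrite -renorm_iter.
- by rewrite -renorm_iter//= ltNge hn.
apply/set_itvccP; move/andP: xhp => [hx ->]; rewrite andbT.
by apply: ltW; apply: lt_le_trans hx.
Qed.

(** The orbit enters the core. There a point below h is mapped above h, and above
    h the attraction of g applies. *)
Lemma double_attract x : e < x -> x <= p ->
  (forall j n, (j < N.+1)%N -> ~ double_orbits j (iter n f x)) ->
  exists n, (L `|` f @` L) (iter n f x).
Proof.
move=> ex xp avoid.
have main y m : y = iter m f x -> h < y -> y <= p -> exists n, L (iter n f x).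
  move=> yE hy yp; have yhp : h <= y <= p by rewrite yp ltW.
  have [j n jN|n] := cascade_attract casc hy yp.
    rewrite renorm_iter// yE -iterD => Oj.
    by apply: (avoid j.+1 (n.*2 + m)%N) => //; left.
  by rewrite renorm_iter// yE -iterD; exists (n.*2 + m)%N.
have [m /(_ m (leqnn m)) fm] := tent_reach_core core ex xp.
have [yh|hy|yh] := ltgtP (iter m f x) h.
- have [n Ln] : exists n, L (iter n f x).
    apply: (main (iter m.+1 f x) m.+1) => //=.
      by apply: tent_below_fixed => //; case/andP: fm.
    exact: (tent_le_peak (core_tent core)).
  by exists n; left.
- have [n Ln] := main _ m erefl hy (proj2 (andP fm)).
  by exists n; left.
by case: (avoid 0%N m).
Qed.

Lemma cascade_double :
  cascade f e p N.+1 double_u double_v double_orbits.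
Proof.
split; rewrite ?double_cells.
- move=> i iN; rewrite /double_u /double_v; case: ifPn => iN1.
    exact: cascade_lt casc _ iN1.
  have iN2 := upper_cell_index iN iN1; have [hu _] := cell_bounds iN2.
  have uv := cascade_lt casc iN2; have b1 := core_b_gt1 core.
  by rewrite !tent_down_above; [nra | lra | lra].
- exact: double_disjoint.
- move=> x [/cells_above/andP[hx xp]|[y /cells_above/andP[hy yp] <-]].
    by apply/set_itvccP; rewrite xp ltW//; apply: lt_trans hx; exact: tent_Fp_lt_fixed.
  apply/set_itvccP; have /andP[-> h2] : f p <= f y <= h.
    by apply: tent_above_image; rewrite yp ltW.
  by rewrite (le_trans h2)// ltW.
- exact: double_chaotic.
- exact: double_orbit_sub.
- exact: double_orbit.
- exact: double_unstable.
- exact: double_attract.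
- by move=> x n _ xp /=; exact: tent_fixed_preimage.
Qed.

End doubling.

(** Each renormalization squares the lower bound l of the slopes, whereas slopes of
    at least 2 keep the image of the peak value from exceeding e: only finitely
    many renormalizations can follow each other. *)
Lemma tent_cascade n l e r p a b h : 1 < l -> l <= a -> l <= b ->
  2 <= l ^+ (2 ^ n) -> tent_core e r p a b h ->
  exists N u v O, cascade (tent r p a b) e p N u v O.
Proof.
elim: n l e r p a b h => [|n IH] l e r p a b h l1 la lb.
  rewrite expn0 expr1 => l2 [[er a1 b0 pE] b1 rh hp hE eFp]; exfalso.
  have a2 : 2 <= a by exact: le_trans la.
  have b2 : 2 <= b by exact: le_trans lb.
  have : 0 <= (a - 2) * (r - e) by rewrite mulr_ge0// subr_ge0// ltW.
  have : 0 <= (b - 2) * (p - r) by rewrite mulr_ge0// subr_ge0//; nra.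
  by nra.
move=> l2 C; have [norenorm|renorm] := leP (tent r p a b (tent r p a b p)) h.
  have [[er a1 b0 pE] b1 rh hp hE eFp] := C.
  pose F := tent r p a b.
  have cellsE : cells 0 (fun=> F p) (fun=> p) = [set` `[F p, p]].
    apply/seteqP; split=> x; first by case=> i _ /set_itvccP.
    by move=> /set_itvccP xp; exists 0%N.
  exists 0%N, (fun=> F p), (fun=> p), (fun=> set0); split => //.
  - by move=> _ _; apply: lt_trans (tent_Fp_lt_r C) (tent_r_lt_p (core_tent C)).
  - by move=> [|//] [|//].
  - by rewrite cellsE.
  - by rewrite cellsE; exact: (tent_core_chaotic C norenorm).
  - move=> x ex xp _; have [m /(_ m (leqnn m)) Fm] := tent_reach_core C ex xp.
    by exists m; rewrite cellsE; exact/set_itvccP.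
have [h' C'] := renorm_tent_core C renorm.
have [||||N [u [v [Os casc]]]] := IH (l ^+ 2) _ _ _ _ _ _ _ _ _ _ C'.
- by nra.
- by nra.
- by nra.
- by rewrite -exprM -expnS.
by exists N.+1, (double_u r p a b N u v), (double_v r p a b N u v),
  (double_orbits r p a b h Os); exact: cascade_double.
Qed.

End renormalization.

(** * The horseshoe of a tall tent map *)

(** A basic neighbourhood in the product topology. *)
Lemma cantor_prefix (s : cantor_space) n :
  \forall t \near s, forall i, (i < n)%N -> s i = t i.
Proof.
elim: n => [|n IH]; first by near=> t => ?; rewrite ltn0.
near=> t => i; rewrite ltnS leq_eqVlt => /predU1P[|iSn]; last by rewrite (near IH t).
move=> ->; near: t; exists (proj n @^-1` [set s n]).
split => //; suff : @open cantor_space (proj n @^-1` [set s n]) by [].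
by apply: open_comp; [move=> + _; exact: proj_continuous | exact: discrete_open].
Unshelve. all: by end_near. Qed.

Lemma iter_shift n (s : cantor_space) i : iter n Defs.shift s i = s (i + n)%N.
Proof. by elim: n i => [|n IH] i; rewrite ?addn0// iterS /Defs.shift IH addSnnS. Qed.

Section horseshoe.
Context {R : realType}.
Variables (e r p a b : R).
Hypothesis data : tent_data e r p a b.
Hypothesis tall : p - b * (p - r) < e.
Let F := tent r p a b.

(** The two inverses of the tent map, the falling one for [true]. *)
Definition branch (c : bool) (y : R) : R :=
  if c then r + b^-1 * (p - y) else r - a^-1 * (p - y).

Fixpoint word (s : cantor_space) n (y : R) : R :=
  if n is m.+1 then branch (s 0%N) (word (Defs.shift s) m y) else y.

Definition horseshoe : set R := [set x | forall n, e <= iter n F x <= p].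

(** The horseshoe avoids the interval above this point, which maps below e. *)
Definition horseshoe_top : R := r + b^-1 * (p - e).

Lemma slope_inv : [/\ 0 < a^-1, 0 < b^-1, b * b^-1 = 1 & a^-1 * (p - e) = r - e].
Proof.
have [er a1 b0 pE] := data; have a0 : 0 < a by lra.
split; rewrite ?invr_gt0// ?mulfV ?gt_eqF//.
by rewrite pE addrAC subrr add0r mulKf// gt_eqF.
Qed.

Lemma top_lt_peak : horseshoe_top < p.
Proof.
have [_ ib0 ib _] := slope_inv; rewrite /horseshoe_top.
have t := tall; move: (b^-1) ib0 ib t => i i0 ib t.
have : i * (p - e) < i * (b * (p - r)) by rewrite ltr_pM2l//; lra.
have -> : i * (b * (p - r)) = (b * i) * (p - r) by ring.
by rewrite ib; lra.
Qed.

Lemma branch_bounds c y : e <= y <= p -> e <= branch c y <= horseshoe_top.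
Proof.
have [er a1 b0 pE] := data; have rp := tent_r_lt_p data.
move=> /andP[ey yp]; have [ia0 ib0 ib ia] := slope_inv.
rewrite /branch /horseshoe_top; move: (a^-1) (b^-1) ia0 ib0 ib ia => j i j0 i0 ib ja.
by case: c; apply/andP; split; nra.
Qed.

Lemma branch_inside c y : e <= y <= p -> e <= branch c y <= p.
Proof.
move=> /(branch_bounds c)/andP[-> h] /=; apply: le_trans h _.
exact/ltW/top_lt_peak.
Qed.

Lemma branchK c y : y <= p -> F (branch c y) = y.
Proof.
have [er a1 b0 pE] := data; have [ia0 ib0 ib _] := slope_inv.
have ia : a * a^-1 = 1 by rewrite mulfV// gt_eqF//; lra.
move=> yp; have pos t : 0 < t -> 0 <= t * (p - y).
  by move=> t0; apply: mulr_ge0; [exact: ltW | rewrite subr_ge0].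
rewrite /F /branch; case: c.
  rewrite (tent_down data); last by rewrite lerDl pos.
  have -> : b * (r + b^-1 * (p - y) - r) = b * b^-1 * (p - y) by ring.
  by rewrite ib; ring.
rewrite (tent_up data); last by rewrite lerBlDr lerDl pos.
have -> : a * (r - (r - a^-1 * (p - y))) = a * a^-1 * (p - y) by ring.
by rewrite ia; ring.
Qed.

Lemma branch_tent x : branch (r < x) (F x) = x.
Proof.
have [er a1 b0 pE] := data; have [ia0 ib0 ib _] := slope_inv.
have ia : a * a^-1 = 1 by rewrite mulfV// gt_eqF//; lra.
rewrite /F /branch; case: ltP => rx.
  rewrite (tent_down data (ltW rx)).
  have -> : b^-1 * (p - (p - b * (x - r))) = b * b^-1 * (x - r) by ring.
  by rewrite ib; ring.
rewrite (tent_up data)//.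
have -> : a^-1 * (p - (p - a * (r - x))) = a * a^-1 * (r - x) by ring.
by rewrite ia; ring.
Qed.

(** A slope of at most 1 would keep F p above r, hence above e. *)
Lemma tall_slope_gt1 : 1 < b.
Proof.
have [er a1 b0 pE] := data; have rp := tent_r_lt_p data; have t := tall.
rewrite ltNge; apply/negP => b1; nra.
Qed.

Lemma branch_contracts : exists k : R, [/\ 0 < k, k < 1 & forall c y z,
  `|branch c y - branch c z| <= k * `|y - z|].
Proof.
have [er a1 b0 pE] := data; have [ia0 ib0 _ _] := slope_inv; have b1 := tall_slope_gt1.
exists (Num.max a^-1 b^-1); split.
- by rewrite lt_max ia0.
- by rewrite gt_max !invf_lt1//; [rewrite a1 | lra].
move=> c y z; rewrite /branch.
have absE (t : R) : 0 < t -> `|t * (z - y)| = t * `|y - z|.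
  by move=> t0; rewrite normrM gtr0_norm// distrC.
case: c.
  have -> : r + b^-1 * (p - y) - (r + b^-1 * (p - z)) = b^-1 * (z - y) by ring.
  by rewrite absE// ler_wpM2r// le_max lexx orbT.
have -> : r - a^-1 * (p - y) - (r - a^-1 * (p - z)) = - (a^-1 * (z - y)) by ring.
by rewrite normrN absE// ler_wpM2r// le_max lexx.
Qed.

(** The sides of the turning point visited by the orbit of x. *)
Definition code (x : R) : cantor_space := fun n => r < iter n F x.

Lemma code_iter x n : code (iter n F x) = iter n Defs.shift (code x).
Proof.
by apply: funext => i; rewrite iter_shift /code -iterD.
Qed.

Lemma horseshoe_iter x n : horseshoe x -> horseshoe (iter n F x).
Proof. by move=> hx m; rewrite -iterD. Qed.

(** Every itinerary is realized by exactly one point: the words with a common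
    beginning are close to each other, since the branches contract. *)
Lemma itinerary_point : exists2 g : cantor_space -> R,
  (forall s, e <= g s <= p) & (forall s, g s = branch (s 0%N) (g (Defs.shift s))).
Proof.
have [er a1 b0 pE] := data; have rp := tent_r_lt_p data.
have [k [k0 k1 contr]] := branch_contracts.
pose C := (p - e) / (1 - k).
have CE : (1 - k) * C = p - e by rewrite /C mulrC divfK// gt_eqF//; lra.
have C0 : 0 < C by rewrite divr_gt0//; lra.
have inside s n : e <= word s n e <= p.
  elim: n s => [|n IH] s /=; last exact: branch_inside.
  by rewrite lexx; lra.
have consec s n : `|word s n e - word s n.+1 e| <= k ^+ n * (p - e).
  elim: n s => [|n IH] s.
    rewrite expr0 mul1r; have /andP[] := inside s 1%N; rewrite [word s 0 e]/=.
    by rewrite ler_norml => h1 h2; apply/andP; split; lra.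
  rewrite [word s n.+1 e]/= [word s n.+2 e]/=.
  by apply: le_trans (contr _ _ _) _; rewrite exprS -mulrA ler_pM2l.
have /(_ _)/cid2 gex s : exists2 x, e <= x <= p & forall n, `|word s n e - x| <= k ^+ n * C.
  have [||x xP] := @nested_balls R (word s ^~ e) (fun n => k ^+ n * C).
  - by move=> n; rewrite mulr_gt0// exprn_gt0.
  - move=> n; have := consec s n; rewrite -CE exprS.
    by move: (k ^+ n) => K; lra.
  exists x => //; have small (eps : R) : 0 < eps -> exists n, `|word s n e - x| < eps.
    move=> eps0; have [n] := pow_small C k0 k1 eps0.
    by exists n; apply: le_lt_trans (xP n) _.
  apply/andP; split; rewrite leNgt; apply/negP => h.
    have [n] := small (e - x) ltac:(lra); have /andP[h1 _] := inside s n.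
    by rewrite ltr_norml => /andP[_ h2]; lra.
  have [n] := small (x - p) ltac:(lra); have /andP[_ h1] := inside s n.
  by rewrite ltr_norml => /andP[h2 _]; lra.
exists (fun s => s2val (gex s)) => s; first exact: (s2valP (gex s)).
have gP t n : `|word t n e - s2val (gex t)| <= k ^+ n * C := s2valP' (gex t) n.
apply/eqP; rewrite -subr_eq0 -normr_le0 leNgt; apply/negP => d0.
have [n lt] := pow_small (2 * C) k0 k1 d0.
pose z := branch (s 0%N) (s2val (gex (Defs.shift s))).
have h1 := gP s n.+1; have h2 : `|word s n.+1 e - z| <= k * _ := contr (s 0%N) _ _.
have := ler_distD (word s n.+1 e) (s2val (gex s)) z.
rewrite (distrC (s2val (gex s)) (word s n.+1 e)) => h3.
have h4 := ler_wpM2l (ltW k0) (gP (Defs.shift s) n).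
have h5 := le_trans h2 h4.
rewrite exprS -mulrA in h1.
have K0 : 0 < k ^+ n * C by rewrite mulr_gt0// exprn_gt0.
rewrite mulrCA in lt; move: (k ^+ n * C) h1 h4 h5 lt K0 => K h1 _ h5 lt K0.
have : k * K < K by rewrite gtr_pMl.
lra.
Qed.


Section itineraries.
Variable g : cantor_space -> R.
Hypothesis g_bounds : forall s, e <= g s <= p.
Hypothesis g_branch : forall s, g s = branch (s 0%N) (g (Defs.shift s)).

Lemma itinerary_tent s : F (g s) = g (Defs.shift s).
Proof. by rewrite g_branch branchK//; case/andP: (g_bounds (Defs.shift s)). Qed.

Lemma itinerary_iter s n : iter n F (g s) = g (iter n Defs.shift s).
Proof. by elim: n => //= n ->; rewrite itinerary_tent. Qed.

Lemma itinerary_horseshoe s : horseshoe (g s).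
Proof. by move=> n; rewrite itinerary_iter. Qed.

Lemma itinerary_top s : g s <= horseshoe_top.
Proof. by rewrite g_branch; case/andP: (branch_bounds (s 0%N) (g_bounds (Defs.shift s))). Qed.

(** The points with itineraries starting with different symbols lie on either
    side of r, at a uniform distance since the horseshoe stays away from p. *)
Lemma itinerary_gap : exists2 d : R, 0 < d &
  forall s, if s 0%N then r + d <= g s else g s <= r - d.
Proof.
have [ia0 ib0 _ _] := slope_inv; have tp := top_lt_peak.
have [d [d0 dj di]] : exists d, [/\ 0 < d, d <= a^-1 & d <= b^-1].
  by exists (Num.min a^-1 b^-1); rewrite lt_min ia0 ib0 !ge_min !lexx orbT.
exists ((p - horseshoe_top) * d); first by rewrite mulr_gt0 ?subr_gt0.
move=> s; rewrite g_branch /branch; have := itinerary_top (Defs.shift s).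
by move: (a^-1) (b^-1) ia0 ib0 dj di => i j i0 j0 dj di gt; case: (s 0%N); nra.
Qed.

Lemma itineraryK : cancel g code.
Proof.
move=> s; apply: funext => n.
have [d d0 /(_ (iter n Defs.shift s))] := itinerary_gap.
rewrite /code itinerary_iter iter_shift add0n; case: (s n) => h.
  by apply/idP; lra.
by apply/negbTE; rewrite -leNgt; lra.
Qed.

Lemma itinerary_close s t n k : (forall c y z,
    `|branch c y - branch c z| <= k * `|y - z|) -> 0 < k ->
  (forall i, (i < n)%N -> s i = t i) -> `|g s - g t| <= k ^+ n * (p - e).
Proof.
move=> contr k0; elim: n s t => [|n IH] s t st.
  have /andP[s1 s2] := g_bounds s; have /andP[t1 t2] := g_bounds t.
  by rewrite expr0 mul1r ler_norml; apply/andP; split; lra.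
rewrite g_branch (g_branch t) st//; apply: le_trans (contr _ _ _) _.
by rewrite exprS -mulrA ler_pM2l//; apply: IH => i ilt; apply: st.
Qed.

Lemma itinerary_near s (eps : R) : 0 < eps -> exists n, forall t,
  (forall i, (i < n)%N -> s i = t i) -> `|g s - g t| < eps.
Proof.
move=> eps0; have [k [k0 k1 contr]] := branch_contracts.
have [n small] := pow_small (p - e) k0 k1 eps0; exists n => t st.
exact: le_lt_trans (itinerary_close contr k0 st) small.
Qed.

(** Both points are obtained from points of [e, p] by the same n inverse branches,
    for every n. *)
Lemma horseshoe_itinerary x : horseshoe x -> g (code x) = x.
Proof.
move=> hx; have [k [k0 k1 contr]] := branch_contracts.
have close n : forall y, horseshoe y -> `|g (code y) - y| <= k ^+ n * (p - e).
  elim: n => [|n IH] y hy.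
    have /andP[s1 s2] := g_bounds (code y); have /andP[t1 t2] : e <= y <= p := hy 0%N.
    by rewrite expr0 mul1r ler_norml; apply/andP; split; lra.
  rewrite g_branch -[X in _ - X]branch_tent; apply: le_trans (contr _ _ _) _.
  rewrite exprS -mulrA ler_pM2l//; have := IH _ (horseshoe_iter 1 hy).
  by rewrite (code_iter y 1).
apply/eqP; rewrite -subr_eq0 -normr_le0 leNgt; apply/negP => d0.
have [n small] := pow_small (p - e) k0 k1 d0.
by have := le_lt_trans (close n x hx) small; rewrite ltxx.
Qed.

Lemma itinerary_image : g @` [set: cantor_space] = horseshoe.
Proof.
apply/seteqP; split=> [_ [s _ <-]|x hx]; first exact: itinerary_horseshoe.
by exists (code x) => //; exact: horseshoe_itinerary.
Qed.

Lemma itinerary_continuous : continuous g.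
Proof.
move=> s; apply/cvgrPdist_lt => eps eps0.
have [n close] := itinerary_near s eps0.
by apply: filterS (cantor_prefix s n) => t /close.
Qed.

Lemma horseshoe_compact : compact horseshoe.
Proof.
rewrite -itinerary_image; apply: continuous_compact; last exact: cantor_space_compact.
exact/continuous_subspaceT/itinerary_continuous.
Qed.

(** A continuous bijection from a compact space is closed, hence the coding map
    is continuous. *)
Lemma code_continuous : {within horseshoe, continuous code}.
Proof.
apply/continuous_closedP => C clC; apply/closed_subspaceP.
exists (g @` C).
  apply: compact_closed; first exact: Rhausdorff.
  apply: continuous_compact; first exact/continuous_subspaceT/itinerary_continuous.
  exact: subclosed_compact clC cantor_space_compact _.
apply/seteqP; split=> x [Cx hx]; split => //; last first.
  by exists (code x) => //; exact: horseshoe_itinerary.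
by case: Cx => s Cs <-; have : C (code (g s)) by rewrite itineraryK.
Qed.

Lemma horseshoe_conjugate : conjugate_to_shift F horseshoe.
Proof.
exists code, g; split.
- exact: code_continuous.
- exact: itinerary_continuous.
- exact: itinerary_horseshoe.
- exact: itineraryK.
by move=> x hx; rewrite horseshoe_itinerary// (code_iter x 1).
Qed.

Definition flip (s : cantor_space) n : cantor_space :=
  fun i => if i == n then ~~ s i else s i.

Lemma horseshoe_cantor : cantor_set horseshoe.
Proof.
have clH : closed horseshoe by apply: compact_closed horseshoe_compact; exact: Rhausdorff.
split.
- exists (g (fun=> true)); exact: itinerary_horseshoe.
- exact: horseshoe_compact.
- split => //; apply/seteqP; split=> x.
    by move=> /subset_limit_point; rewrite -(iffLR (closure_id _) clH).
  move=> hx U /nbhs_ballP[eps /= eps0 sub].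
  have [n close] := itinerary_near (code x) eps0.
  exists (g (flip (code x) n)); split; last 2 first.
  + exact: itinerary_horseshoe.
  + apply: sub; rewrite /ball /= -{1}(horseshoe_itinerary hx); apply: close => i ilt.
    by rewrite /flip ltn_eqF.
  apply/eqP => gx; have := congr1 (fun y => code y n) gx.
  by rewrite itineraryK /flip eqxx; case: (code x n).
move=> x hx; apply/seteqP; split=> [y Cy|_ ->]; last exact: connected_component_refl.
have hsub := @connected_component_sub _ horseshoe x.
have conn : connected (code @` connected_component horseshoe x).
  apply: connected_continuous_connected; first exact: component_connected.
  exact: continuous_subspaceW hsub code_continuous.
have := zero_dimension_totally_disconnected cantor_zero_dimensional
  (I : [set: cantor_space] (code x)).
have csub := @connected_component_max _ [set: cantor_space] _ (code x) _ _ conn.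
move=> E; have : connected_component [set: cantor_space] (code x) (code y).
  apply: csub; [|by []|by exists y].
  by exists x => //; exact: connected_component_refl.
rewrite E => /= cxy.
by rewrite -(horseshoe_itinerary hx) -(horseshoe_itinerary (hsub _ Cy)) cxy.
Qed.

Lemma horseshoe_chaotic : devaney_chaotic F horseshoe.
Proof.
have clH : closed horseshoe by apply: compact_closed horseshoe_compact; exact: Rhausdorff.
have iterg s n i : code (iter n F (g s)) i = s (i + n)%N.
  by rewrite code_iter itineraryK iter_shift.
split => //.
- by move=> _ [x hx <-]; exact: (horseshoe_iter 1).
- move=> x hx; apply/closure_distP => eps eps0.
  have [n close] := itinerary_near (code x) eps0.
  (* the periodic itinerary repeating the first n + 1 symbols *)
  pose t : cantor_space := fun i => code x (i %% n.+1)%N.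
  exists (g t); last first.
    rewrite -{1}(horseshoe_itinerary hx); apply: close => i ilt.
    by rewrite /t modn_small// ltnS ltnW.
  split; first exact: itinerary_horseshoe.
  apply: (@periodic_pointP _ _ _ n.+1) => //; rewrite itinerary_iter.
  by congr g; apply: funext => i; rewrite iter_shift /t modnDr.
- have [d d0 gap] := itinerary_gap.
  exists d => // x hx eps eps0.
  have [n close] := itinerary_near (code x) eps0.
  exists (g (flip (code x) n)); split; first exact: itinerary_horseshoe.
    rewrite -{1}(horseshoe_itinerary hx); apply: close => i ilt.
    by rewrite /flip ltn_eqF.
  exists n; rewrite -{1}(horseshoe_itinerary hx) !itinerary_iter.
  have := gap (iter n Defs.shift (code x)); have := gap (iter n Defs.shift (flip (code x) n)).
  rewrite !iter_shift add0n {1}/flip eqxx.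
  case: (code x n) => /= h1 h2.
    by apply: lt_le_trans (ler_norm _); lra.
  by rewrite distrC; apply: lt_le_trans (ler_norm _); lra.
apply: transitive_dense_orbit => //; first exact: tent_continuous.
  by exists (g (fun=> true)); exact: itinerary_horseshoe.
move=> x y eps hx hy eps0.
have [n close] := itinerary_near (code x) eps0.
(* start like x, then continue like y *)
pose t : cantor_space := fun i => if (i < n)%N then code x i else code y (i - n)%N.
exists (g t); split; first exact: itinerary_horseshoe.
  by rewrite -{1}(horseshoe_itinerary hx); apply: close => i ilt; rewrite /t ilt.
exists n; rewrite itinerary_iter.
have -> : iter n Defs.shift t = code y.
  by apply: funext => i; rewrite iter_shift /t ltnNge leq_addl/= addnK.
by rewrite horseshoe_itinerary// subrr normr0.
Qed.

End itineraries.

Lemma horseshoe_properties : [/\ devaney_chaotic F horseshoe,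
  cantor_set horseshoe & conjugate_to_shift F horseshoe].
Proof.
have [g gb gs] := itinerary_point; split.
- exact: horseshoe_chaotic gb gs.
- exact: horseshoe_cantor gb gs.
- exact: horseshoe_conjugate gb gs.
Qed.

End horseshoe.

(** * Saw maps near one of their teeth *)

Section saw_tooth.
Context {R : realType}.

Lemma closure_itvoo (u v : R) : u < v -> closure [set` `]u, v[] = [set` `[u, v]].
Proof.
move=> uv; apply/seteqP; split; first exact: itv_closure.
move=> x /set_itvccP /andP[ux xv]; apply/closure_distP => eps eps0.
have [xm|mx] := leP x ((u + v) / 2).
  exists (Num.min (x + eps / 2) ((u + v) / 2 + (v - u) / 4)).
    rewrite /= in_itv /= lt_min gt_min; apply/andP; split.
      by apply/andP; split; lra.
    by apply/orP; right; lra.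
  have : Num.min (x + eps / 2) ((u + v) / 2 + (v - u) / 4) <= x + eps / 2.
    by rewrite ge_min lexx.
  have : x < Num.min (x + eps / 2) ((u + v) / 2 + (v - u) / 4).
    by rewrite lt_min; apply/andP; split; lra.
  by move: (Num.Def.minr _ _) => y h1 h2; rewrite ltr_norml; apply/andP; split; lra.
exists (Num.max (x - eps / 2) ((u + v) / 2 - (v - u) / 4)).
  rewrite /= in_itv /= gt_max lt_max; apply/andP; split.
    by apply/orP; right; lra.
  by apply/andP; split; lra.
have : x - eps / 2 <= Num.max (x - eps / 2) ((u + v) / 2 - (v - u) / 4).
  by rewrite le_max lexx.
have : Num.max (x - eps / 2) ((u + v) / 2 - (v - u) / 4) < x.
  by rewrite gt_max; apply/andP; split; lra.
by move: (Num.Def.maxr _ _) => y h1 h2; rewrite ltr_norml; apply/andP; split; lra.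
Qed.

Variables (p r q : nat -> R) (T : R -> R).
Hypothesis T_saw : saw_map p r q T.

Lemma saw_upE k x : q k.+1 <= x <= r k -> T x = saw_alpha p r q k * (x - q k.+1).
Proof.
have qr := saw_qr T_saw k; have [m [c mc]] := saw_affine_up T_saw k.
have mcE y : q k.+1 <= y <= r k -> T y = m * y + c by move=> ?; apply: mc; rewrite in_itv.
move=> /[dup] xk /mcE ->.
have Tq : m * q k.+1 + c = 0 by rewrite -mcE ?(saw_Tq T_saw)// lexx ltW.
have Tr : m * r k + c = p k by rewrite -mcE ?(saw_Tr T_saw)// lexx ltW.
have -> : saw_alpha p r q k = m.
  rewrite /saw_alpha -Tr; have -> : c = - (m * q k.+1) by lra.
  by rewrite -mulrBr mulfK// subr_eq0 gt_eqF.
by rewrite mulrBr; lra.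
Qed.

Lemma saw_downE k x : r k.+1 <= x <= q k.+1 ->
  T x = saw_beta p r q k.+1 * (q k.+1 - x).
Proof.
have rq := saw_rq T_saw k; have [m [c mc]] := saw_affine_down T_saw k.
have mcE y : r k.+1 <= y <= q k.+1 -> T y = m * y + c by move=> ?; apply: mc; rewrite in_itv.
move=> /[dup] xk /mcE ->.
have Tq : m * q k.+1 + c = 0 by rewrite -mcE ?(saw_Tq T_saw)// lexx ltW.
have Tr : m * r k.+1 + c = p k.+1 by rewrite -mcE ?(saw_Tr T_saw)// lexx ltW.
have -> : saw_beta p r q k.+1 = - m.
  rewrite /saw_beta -Tr; have -> : c = - (m * q k.+1) by lra.
  have -> : m * r k.+1 - m * q k.+1 = - m * (q k.+1 - r k.+1) by ring.
  by rewrite mulfK// subr_eq0 gt_eqF.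
by rewrite mulrBr; lra.
Qed.

Lemma saw_p_le m n : (m <= n)%N -> p n <= p m.
Proof.
move=> /subnK <-; elim: (n - m)%N => // j; apply: le_trans.
by rewrite addSn; apply/ltW/(saw_p_decr T_saw).
Qed.

Lemma saw_p_lt_r0 k : p k < r 0%N.
Proof. exact: le_lt_trans (saw_p_le (leq0n k)) (saw_p0_r0 T_saw). Qed.

Lemma saw_alphaE k : saw_alpha p r q k * (r k - q k.+1) = p k.
Proof. by rewrite /saw_alpha divfK// subr_eq0 gt_eqF// (saw_qr T_saw). Qed.

Lemma saw_betaE k : saw_beta p r q k.+1 * (q k.+1 - r k.+1) = p k.+1.
Proof. by rewrite /saw_beta divfK// subr_eq0 gt_eqF// (saw_rq T_saw). Qed.

Variable k : nat.
Let a := saw_alpha p r q k.+1.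
Let b := saw_beta p r q k.+1.
Let e := saw_e r q T k.+1.
Let rk := r k.+1.
Let pk := p k.+1.
Let F := tent rk pk a b.

Lemma saw_alpha_gt1 : 1 < a.
Proof.
have h1 := saw_qr T_saw k.+1; have h2 := saw_rp T_saw k; have h3 := saw_q_gt0 T_saw k.+1.
rewrite /a /saw_alpha ltr_pdivlMr ?subr_gt0// mul1r; lra.
Qed.

Lemma saw_beta_gt0 : 0 < b.
Proof.
by rewrite /b /saw_beta divr_gt0// ?(saw_p_gt0 T_saw)// subr_gt0 (saw_rq T_saw).
Qed.

Lemma saw_eP : [/\ q k.+2 < e, e < rk & T e = e].
Proof.
have a1 := saw_alpha_gt1; have aE : a * (rk - q k.+2) = pk := saw_alphaE k.+1.
have h1 : q k.+2 < rk := saw_qr T_saw k.+1.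
have h2 : rk < pk := saw_rp T_saw k; have h3 := saw_q_gt0 T_saw k.+1.
suff /getPex[] : exists x, [set x | q k.+2 < x < r k.+1 /\ T x = x] x.
  by rewrite -/e => /andP[].
have a10 : a - 1 != 0 by rewrite subr_eq0 gt_eqF.
have [x xE] : exists x, (a - 1) * x = a * q k.+2.
  by exists (a * q k.+2 / (a - 1)); rewrite mulrC divfK.
have xq : q k.+2 < x < rk by apply/andP; split; nra.
exists x; split => //; rewrite (@saw_upE k.+1); first by rewrite -/a; lra.
by move/andP: xq => [x1 x2]; rewrite !ltW.
Qed.

Lemma saw_e_gt0 : 0 < e.
Proof. by have [h _ _] := saw_eP; apply: lt_trans h; exact: (saw_q_gt0 T_saw). Qed.

Lemma saw_tent_data : tent_data e rk pk a b.
Proof.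
have [qe er Te] := saw_eP; have aE : a * (rk - q k.+2) = pk := saw_alphaE k.+1.
split => //; [exact: saw_alpha_gt1 | exact: saw_beta_gt0|].
move: Te; rewrite (@saw_upE k.+1) -/a; first by lra.
by rewrite !ltW.
Qed.

Lemma saw_tentE x : q k.+2 <= x <= q k.+1 -> T x = F x.
Proof.
have aE : a * (rk - q k.+2) = pk := saw_alphaE k.+1.
have bE : b * (q k.+1 - rk) = pk := saw_betaE k; have D := saw_tent_data.
move=> /andP[x1 x2]; rewrite /F; have [xr|/ltW rx] := leP x rk.
  by rewrite (tent_up D xr) (@saw_upE k.+1) ?x1// -/a; lra.
by rewrite (tent_down D rx) (@saw_downE k) ?x2 ?andbT// -/b; lra.
Qed.

Lemma saw_tent_in : pk <= q k.+1 -> {in [set` `[e, pk]], T =1 F}.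
Proof.
move=> pq x /set_mem/set_itvccP/andP[ex xp]; apply: saw_tentE.
have [qe _ _] := saw_eP; apply/andP; split; last exact: le_trans pq.
by apply: le_trans ex; exact: ltW.
Qed.

Lemma saw_phase : [set` `[e, pk]] `<=` sawJ r.
Proof.
move=> x /set_itvccP/andP[ex xp]; apply/set_itvccP; have := saw_p_lt_r0 k.+1.
have := saw_e_gt0; rewrite -/pk => e0 pr; apply/andP; split; lra.
Qed.

(** The inverse slopes measure the two halves of the tooth in units of its
    height, so that their sum decides whether the peak value falls below e. *)
Lemma saw_image_peak : pk - b * (pk - rk) - e = b * (pk - e) * (a^-1 + b^-1 - 1).
Proof.
have [er a1 b0 pE] := saw_tent_data.
have ia : (pk - e) * a^-1 = rk - e by rewrite pE; field; lra.
have ib : b * b^-1 = 1 by rewrite mulfV// gt_eqF.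
have -> : b * (pk - e) * (a^-1 + b^-1 - 1) =
    b * ((pk - e) * a^-1) + (pk - e) * (b * b^-1) - b * (pk - e) by ring.
by rewrite ia ib; ring.
Qed.

(** A sum of inverse slopes above 1 keeps the peak value left of the zero q_k. *)
Lemma saw_inverse_slopes : pk * (a^-1 + b^-1) = q k.+1 - q k.+2.
Proof.
have [er a1 b0 pE] := saw_tent_data.
have a0 : a != 0 by rewrite gt_eqF//; lra.
have aE : a * (rk - q k.+2) = pk := saw_alphaE k.+1.
have bE : b * (q k.+1 - rk) = pk := saw_betaE k.
rewrite mulrDr -{1}aE -bE mulrAC mulfV// mul1r.
by rewrite mulrAC mulfV ?gt_eqF// mul1r; lra.
Qed.

Lemma saw_ehatP h : [/\ rk < h, h < q k.+1 & T h = h] <->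
  [/\ rk < h, h < pk & pk - b * (h - rk) = h].
Proof.
have b0 := saw_beta_gt0; have bE : b * (q k.+1 - rk) = pk := saw_betaE k.
have r0 : 0 < rk := saw_r_gt0 T_saw _.
have D := saw_tent_data.
split=> [[rh hq Th] | [rh hp hE]].
  have hE : pk - b * (h - rk) = h.
    by rewrite -[RHS]Th (@saw_downE k) ?ltW// -/b; lra.
  by split => //; nra.
have hq : h < q k.+1 by nra.
by split => //; rewrite (@saw_downE k) ?ltW// -/b; lra.
Qed.

Lemma saw_ehat_fixed : let h := saw_ehat r q T k.+1 in
  [/\ rk < h, h < pk & pk - b * (h - rk) = h].
Proof.
have [h /andP[rh hp] hE] := tent_down_fixed saw_tent_data.
have [h1 h2 h3] := (saw_ehatP h).2 (And3 rh hp hE).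
have /getPex : exists x, [set x | rk < x < q k.+1 /\ T x = x] x.
  by exists h; rewrite /= h1 h2.
rewrite -/(saw_ehat r q T k.+1) => -[/andP[g1 g2] g3] /=.
exact/saw_ehatP.
Qed.

Lemma saw_invariant : pk <= q k.+1 -> e <= F pk ->
  invariant_set T [set` `[e, pk]].
Proof.
move=> pq eF _ [x xA <-]; rewrite saw_tent_in ?inE//.
by apply: (tent_invariant saw_tent_data eF); exists x.
Qed.

(** A falling slope below 1 makes the falling side a trap on which the distance
    to the fixed point shrinks. *)
Lemma saw_attracting : b < 1 ->
  let h := saw_ehat r q T k.+1 in
  [/\ invariant_set T [set` `[e, pk]],
      [set` `[e, pk]] h,
      stable_set (sawJ r) T [set h] &
      [set` `[e, pk]] `\ e `<=` basin (sawJ r) T h].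
Proof.
move=> b1 h; have D := saw_tent_data; have [er a1 b0 pE] := D.
have rp := tent_r_lt_p D; have r0 : 0 < rk := saw_r_gt0 T_saw _.
have [rh hp hE] : [/\ rk < h, h < pk & pk - b * (h - rk) = h] := saw_ehat_fixed.
have pq : pk <= q k.+1 by have bE : b * (q k.+1 - rk) = pk := saw_betaE k; nra.
have FpE : F pk = pk - b * (pk - rk) by exact/(tent_down D)/ltW.
have inv := saw_invariant pq ltac:(by rewrite FpE; nra).
have TF := eq_iter_in (tent_invariant D ltac:(by rewrite -/F FpE; nra)) (saw_tent_in pq).
have trap x n : rk <= x <= pk ->
    rk <= iter n F x <= pk /\ `|iter n F x - h| <= b ^+ n * `|x - h|.
  move=> xrp; elim: n => [|n [/andP[ry yp] IH]]; first by rewrite expr0 mul1r.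
  have yE : F (iter n F x) = pk - b * (iter n F x - rk) by exact: (tent_down D).
  rewrite iterS yE; split; first by apply/andP; split; nra.
  have -> : pk - b * (iter n F x - rk) - h = - (b * (iter n F x - h)) by lra.
  by rewrite normrN normrM gtr0_norm// exprS -mulrA ler_pM2l.
have A_of_rp x : rk <= x <= pk -> [set` `[e, pk]] x.
  by move=> /andP[rx xp]; apply/set_itvccP; rewrite xp andbT; lra.
split => //.
- by apply: A_of_rp; rewrite !ltW.
- move=> U oU hU.
  have /nbhs_ballP[eps /= eps0 sub] := open_nbhs_nbhs (conj oU (hU _ (erefl h))).
  have [d [d0 deps dr dp]] : exists d : R, [/\ 0 < d, d <= eps, d <= h - rk & d <= pk - h].
    exists (Num.min eps (Num.min (h - rk) (pk - h))).
    by rewrite !lt_min !ge_min !lexx !orbT eps0 !subr_gt0 rh hp.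
  exists (ball h d); split; first exact: ball_open.
    by move=> _ ->; exact: ballxx.
  move=> x; rewrite /ball /= => hx Jx n; apply: sub; rewrite /ball /=.
  have xrp : rk <= x <= pk.
    by move: hx; rewrite ltr_norml => /andP[h1 h2]; apply/andP; split; lra.
  rewrite (TF x n (A_of_rp _ xrp)) distrC.
  apply: le_lt_trans (trap x n xrp).2 _.
  have : b ^+ n <= 1 by rewrite exprn_ile1// ltW.
  move: (b ^+ n) => B B1; rewrite distrC; have := normr_ge0 (h - x); nra.
move=> x [/set_itvccP/andP[ex xp] xe]; have xA : [set` `[e, pk]] x.
  by apply/set_itvccP; rewrite ex.
split; first exact: saw_phase.
have ex' : e < x by rewrite lt_neqAle ex andbT eq_sym; apply/eqP.
have [n0 n0P] := tent_reach D (lexx rk) ex' xp.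
apply/cvgrPdist_lt => eps eps0.
have [n small] := pow_small `|iter n0 F x - h| b0 b1 eps0.
exists (n + n0)%N => // m /= nm.
rewrite TF// -(subnK (leq_trans (leq_addl _ _) nm)) iterD distrC.
apply: le_lt_trans (trap _ _ n0P).2 _; apply: le_lt_trans small.
apply: ler_wpM2r => //; apply: ler_wiXn2l; rewrite ?ltW//.
by rewrite -(leq_add2r n0) subnK// (leq_trans _ nm)// leq_addl.
Qed.

(** The interval is modelled by a tent map with both slopes above 1 and with the
    image of its peak value above e, to which the cascade applies. *)
Lemma saw_cascade : 1 < b -> 1 < a^-1 + b^-1 ->
  let G := sawG r T k.+1 in
  [/\ invariant_set T [set` `[e, pk]],
      G `<=` [set` `[e, pk]],
      invariant_set T G,
      exists (N : nat) (u v : 'I_(2 ^ N) -> R) (O : 'I_N -> set R),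
        let A := fun i => [set` `]u i, v i[] in
        let Lambda := \bigcup_i closure (A i) in
        [/\ (forall i, u i < v i) /\ trivIset setT A,
            Lambda `<=` G /\ devaney_chaotic T Lambda,
            (forall j : 'I_N,
              [/\ O j `<=` G `\` Lambda,
                  periodic_orbit T (2 ^ j) (O j) &
                  ~ stable_set (sawJ r) T (O j)]) &
            forall x, (G `\` (Lambda `|` \bigcup_j O j)) x ->
              (forall (j : 'I_N) n, (0 < j)%N -> ~ O j (iter n T x)) ->
              exists n0, forall n, (n0 <= n)%N -> Lambda (iter n T x)] &
      forall y, ([set` `[e, pk]] `\` (G `|` [set e])) y ->
        exists n1, forall n, (n1 <= n)%N -> G (iter n T y)].
Proof.
move=> b1 sum1 G; have D := saw_tent_data; have [er a1 b0 pE] := D.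
have rp := tent_r_lt_p D; have r0 : 0 < rk := saw_r_gt0 T_saw _.
have p0 : 0 < pk by lra.
have pq : pk <= q k.+1.
  have := saw_inverse_slopes; have := saw_q_gt0 T_saw k.+1.
  by move: sum1; move: (a^-1 + b^-1) => s; nra.
have eFp : e < pk - b * (pk - rk).
  rewrite -subr_gt0 saw_image_peak; apply: mulr_gt0; last by rewrite subr_gt0.
  by apply: mulr_gt0 => //; lra.
have [rh hp hE] := saw_ehat_fixed.
have C : tent_core e rk pk a b (saw_ehat r q T k.+1) by split.
have FpE : F pk = pk - b * (pk - rk) := tent_image_peak C.
have eF : e <= F pk by rewrite FpE ltW.
have Finv := tent_invariant D eF.
have TFin := saw_tent_in pq; have TF := eq_iter_in Finv TFin.
have GE : G = [set` `[F pk, pk]].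
  rewrite /G /sawG (saw_Tr T_saw) -/pk TFin// inE; apply/set_itvccP.
  by rewrite lexx andbT; lra.
have GA : G `<=` [set` `[e, pk]].
  rewrite GE => x /set_itvccP/andP[px xp]; apply/set_itvccP.
  by rewrite xp andbT; exact: le_trans px.
have reach x : e < x -> x <= pk -> exists n0, forall n, (n0 <= n)%N -> G (iter n T x).
  move=> ex xp; have [n0 n0P] := tent_reach_core C ex xp; exists n0 => n /n0P h.
  rewrite TF; first by rewrite GE; exact/set_itvccP.
  by apply/set_itvccP; rewrite xp ltW.
have Ginv : invariant_set T G.
  move=> _ [x Gx <-]; rewrite TFin ?inE; last exact: GA.
  by move: Gx; rewrite GE => /set_itvccP xp; exact/set_itvccP/(tent_core_invariant C).
split => //.
- exact: saw_invariant.
- have [l [l1 la lb]] : exists l, [/\ 1 < l, l <= a & l <= b].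
    by exists (Num.min a b); rewrite lt_min a1 b1 !ge_min !lexx orbT.
  have [n l2] := pow_unbounded 2 l1.
  have l2' : 2 <= l ^+ (2 ^ n).
    by apply/ltW/(lt_le_trans l2); rewrite ler_eXn2l// ltnW// ltn_expl.
  have [N [u [v [Os casc]]]] := tent_cascade l1 la lb l2' C.
  exists N, (fun i => u i), (fun i => v i), (fun j => Os j).
  move=> A L.
  have LE : L = cells N u v.
    apply/seteqP; split=> [x [i _]|x [i iN ux]].
      rewrite /A closure_itvoo ?(cascade_lt casc)// => /set_itvccP ux.
      by exists i.
    exists (Ordinal iN) => //; rewrite /A closure_itvoo; first exact/set_itvccP.
    exact: (cascade_lt casc).
  have LG : L `<=` G by rewrite LE GE; exact: cascade_sub casc.
  have [clL Linv _ _ _] := cascade_chaotic casc.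
  have Tchaos : devaney_chaotic T L.
    rewrite LE; apply: eq_devaney_chaotic (cascade_chaotic casc) => //.
    by move=> x /set_mem Lx; apply: TFin; rewrite inE; apply/GA/LG; rewrite LE.
  have orbA (j : 'I_N) x : Os j x -> [set` `[e, pk]] x.
    by move=> /(cascade_orbit_sub casc (ltn_ord j))[+ _]; rewrite -/F -GE; exact: GA.
  split => //.
  + split=> [i|]; first exact: cascade_lt casc _ (ltn_ord i).
    move=> i j _ _ [x []]; rewrite /A /= !in_itv /= => /andP[h1 h2] /andP[h3 h4].
    apply/val_inj/(cascade_disjoint casc (x := x) (ltn_ord i) (ltn_ord j));
      by apply/andP; split; exact: ltW.
  + move=> j; split.
    * by rewrite LE GE; exact: cascade_orbit_sub casc _ (ltn_ord j).
    * have [x [n0 Fx Fmin] OE] := cascade_orbit casc (ltn_ord j).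
      have xA : [set` `[e, pk]] x by apply: (@orbA j); rewrite OE; exists 0%N.
      exists x; first by split; rewrite ?TF// => m /Fmin; rewrite TF.
      rewrite OE /orbit_of; suff -> : (fun m => iter m F x) = (fun m => iter m T x) by [].
      by apply: funext => m; rewrite TF.
    * move=> stab; apply: (cascade_unstable casc (ltn_ord j)) => U oU OU.
      have [V [oV OV VU]] := stab U oU OU; exists V; split => // x Vx xA m.
      by rewrite -TF//; apply: VU => //; exact: saw_phase.
  + move=> x [Gx nLO] avoid.
    have xA := GA _ Gx; have xp := Gx; rewrite GE in xp; move/set_itvccP: xp => xp.
    have [||j m jN Oj|m Lm] := cascade_attract casc (x := x).
    * by apply: lt_le_trans (proj1 (andP xp)); rewrite FpE.
    * by case/andP: xp.
    * case: j => [|j] in jN Oj; last by apply: (avoid (Ordinal jN) m); rewrite //= TF.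
      apply: nLO; right; exists (Ordinal jN) => //=.
      exact: cascade_fixed casc _ _ jN xp Oj.
    exists m => i /subnK <-; rewrite TF// iterD LE.
    exact: (invariant_iter (A := cells N u v)).
move=> y [/set_itvccP/andP[ey yp] nGe]; apply: reach => //.
by rewrite lt_neqAle ey andbT eq_sym; apply/eqP => ye; apply: nGe; right.
Qed.

(** The zeros accumulate at 0, so that x lies on some tooth further to the left,
    and peaks decrease to the left. *)
Lemma saw_teeth x : 0 < x -> x <= q k.+2 -> 0 <= T x <= p k.+2.
Proof.
move=> x0 xq.
have ex : exists n, q (k.+2 + n).+1 < x.
  have /cvgrPdist_lt/(_ _ x0)[n _ nP] := saw_q_cvg T_saw.
  have := nP (k.+2 + n).+1 (leqW (leq_addl k.+2 n)).
  have q0 : 0 < q (k.+2 + n).+1 := saw_q_gt0 T_saw _.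
  by move=> h; exists n; move: h; rewrite sub0r normrN gtr0_norm.
have [n qn nmin] := ex_minnP ex.
have xqn : x <= q (k.+2 + n)%N.
  case: n qn nmin => [|n] _ nmin; first by rewrite addn0.
  by rewrite leNgt; apply/negP; rewrite addnS => /nmin; rewrite ltnn.
rewrite addSn in qn xqn *; move: (k.+1 + n)%N (leq_addr n k.+1) qn xqn => j kj qj xj.
have pj : p j.+1 <= p k.+2 by exact: saw_p_le.
have j0 := saw_p_gt0 T_saw j.+1; have qr := saw_qr T_saw j.+1; have rq := saw_rq T_saw j.
have aE := saw_alphaE j.+1; have bE := saw_betaE j.
have a0 : 0 < saw_alpha p r q j.+1 by rewrite divr_gt0// subr_gt0.
have b0 : 0 < saw_beta p r q j.+1 by rewrite divr_gt0// subr_gt0.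
have [xr|/ltW rx] := leP x (r j.+1).
  rewrite (@saw_upE j.+1); last by rewrite xr ltW.
  by move: (saw_alpha _ _ _ _) aE a0 => c cE c0; apply/andP; split; nra.
rewrite (@saw_downE j); last by rewrite rx.
by move: (saw_beta _ _ _ _) bE b0 => c cE c0; apply/andP; split; nra.
Qed.

Lemma saw_below_e : p k.+2 < e -> forall x, 0 <= x < e -> 0 <= T x < e.
Proof.
move=> pe x /andP[x0 xe]; have [qe er Te] := saw_eP.
have [xq|/ltW qx] := leP x (q k.+2).
  move: x0; rewrite le_eqVlt => /predU1P[<-|x0]; last first.
    by have /andP[-> h] := saw_teeth x0 xq; exact: le_lt_trans pe.
  by rewrite (saw_T0 T_saw) lexx saw_e_gt0.
have a1 := saw_alpha_gt1; have TE y : q k.+2 <= y <= rk -> T y = a * (y - q k.+2).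
  exact: saw_upE.
have eE : a * (e - q k.+2) = e by rewrite -TE ?Te// !ltW.
rewrite TE; last by rewrite qx; apply: ltW; exact: lt_trans er.
by apply/andP; split; nra.
Qed.

(** Above q_k, the map lands below e again because the peak value is not too far
    beyond q; so an orbit leaving the horseshoe falls below e, and stays there. *)
Lemma saw_horseshoe : a^-1 + b^-1 < 1 -> p k.+2 < e -> pk <= r k ->
  pk < q k.+1 + e / saw_alpha p r q k ->
  exists Lambda : set R,
    [/\ Lambda `<=` [set` `[e, pk]],
        devaney_chaotic T Lambda,
        cantor_set Lambda,
        conjugate_to_shift T Lambda &
        forall x, ([set` `[e, pk]] `\` Lambda) x ->
          exists n2, forall n, (n2 <= n)%N -> iter n T x \in `[0, e[].
Proof.
move=> sum1 pe pr noret; have D := saw_tent_data; have [er a1 b0 pE] := D.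
have rp := tent_r_lt_p D; have [qe _ _] := saw_eP; have e0 := saw_e_gt0.
have rq : rk < q k.+1 := saw_rq T_saw k.
have bE : b * (q k.+1 - rk) = pk := saw_betaE k.
have tall : pk - b * (pk - rk) < e.
  rewrite -subr_lt0 saw_image_peak nmulr_llt0; last by lra.
  by rewrite mulr_gt0// subr_gt0; lra.
have step y : e <= y <= pk -> 0 <= T y < e \/ T y = F y /\ e <= T y <= pk.
  move=> /andP[ey yp]; have [yq|qy] := leP y (q k.+1).
    have TF : T y = F y by apply: saw_tentE; rewrite yq andbT; lra.
    have [ley|lty] := leP e (T y).
      by right; rewrite TF (tent_le_peak D).
    left; rewrite andbT; have [yr|/ltW ry] := leP y rk.
      by rewrite TF /F (tent_upE D yr); nra.
    by rewrite TF /F (tent_down D ry); nra.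
  have ak0 : 0 < saw_alpha p r q k.
    by rewrite divr_gt0// ?(saw_p_gt0 T_saw)// subr_gt0 (saw_qr T_saw).
  left; rewrite (@saw_upE k); last by rewrite (ltW qy) (le_trans yp).
  have : y - q k.+1 < e / saw_alpha p r q k by lra.
  rewrite ltr_pdivlMr// mulrC => ->; rewrite andbT mulr_ge0//; first exact: ltW.
  by rewrite subr_ge0 ltW.
have hor : horseshoe e rk pk a b `<=` [set` `[e, pk]].
  by move=> x hx; exact/set_itvccP/(hx 0%N).
have TF : {in horseshoe e rk pk a b, T =1 F}.
  move=> x /set_mem hx; apply: saw_tentE.
  have /andP[h1 h2] : e <= x <= pk := hx 0%N; have /andP[h3 h4] : e <= F x <= pk := hx 1%N.
  apply/andP; split; first by lra.
  rewrite leNgt; apply/negP => qx; move: h3; rewrite /F (tent_down D); last by lra.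
  by nra.
have [chaos cantor [h [g [hc gc gh gK hg]]]] := horseshoe_properties D tall.
exists (horseshoe e rk pk a b); split => //.
- by have [_ inv _ _ _] := chaos; exact: eq_devaney_chaotic chaos.
- exists h, g; split => // x hx; rewrite TF ?inE//; exact: hg.
move=> x [/set_itvccP xA nhx].
have [[n Tn]|never] := pselect (exists n, 0 <= iter n T x < e).
  exists n => m /subnK <-; rewrite iterD in_itv /=.
  by elim: (m - n)%N => //= i IH; exact: saw_below_e.
exfalso; apply: nhx.
have inside n : iter n T x = iter n F x /\ e <= iter n T x <= pk.
  elim: n => [|n [IH1 IH2]] //.
  have [below|[TFn TA]] := step _ IH2; first by case: never; exists n.+1.
  by rewrite iterS; split => //; rewrite TFn IH1.
by move=> n; have [<-] := inside n.
Qed.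

End saw_tooth.

Theorem theorem2p2 (R : realType) (p r q : nat -> R) (T : R -> R) (kst : nat)
    (T_saw : saw_map p r q T) (T_std : saw_assumptions p r q T kst) :
  let J := sawJ r in
  let e := saw_e r q T in
  let ehat := saw_ehat r q T in
  let alpha := saw_alpha p r q in
  let beta := saw_beta p r q in
  let Jk := sawJk p r q T in
  let G := sawG r T in
  [/\
    (* (a) *)
    forall k, (1 <= k <= kst)%N -> beta k < 1 ->
      [/\ invariant_set T (Jk k),
          Jk k (ehat k),
          stable_set J T [set ehat k] &
          Jk k `\ e k `<=` basin J T (ehat k)],
    (* (b) *)
    forall k, (1 <= k <= kst)%N -> 1 < beta k ->
      1 < (alpha k)^-1 + (beta k)^-1 ->
      [/\ invariant_set T (Jk k),
          G k `<=` Jk k,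
          invariant_set T (G k),
          exists (N : nat) (a b : 'I_(2 ^ N) -> R) (O : 'I_N -> set R),
            let A := fun i => [set` `]a i, b i[] in
            let Lambda := \bigcup_i closure (A i) in
            [/\ (forall i, a i < b i) /\ trivIset setT A,
                Lambda `<=` G k /\ devaney_chaotic T Lambda,
                (forall j : 'I_N,
                  [/\ O j `<=` G k `\` Lambda,
                      periodic_orbit T (2 ^ j) (O j) &
                      ~ stable_set J T (O j)]) &
                (* the second condition excludes the preimages of the orbits
                   of period at least 2, which never enter Lambda *)
                forall x, (G k `\` (Lambda `|` \bigcup_j O j)) x ->
                  (forall (j : 'I_N) n, (0 < j)%N -> ~ O j (iter n T x)) ->
                  exists n0, forall n, (n0 <= n)%N -> Lambda (iter n T x)] &
          forall y, (Jk k `\` (G k `|` [set e k])) y ->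
            exists n1, forall n, (n1 <= n)%N -> G k (iter n T y)] &
    (* (c) *)
    forall k, (1 <= k <= kst.-1)%N -> (alpha k)^-1 + (beta k)^-1 < 1 ->
      exists Lambda : set R,
        [/\ Lambda `<=` Jk k,
            devaney_chaotic T Lambda,
            cantor_set Lambda,
            conjugate_to_shift T Lambda &
            forall x, (Jk k `\` Lambda) x ->
              exists n2, forall n, (n2 <= n)%N ->
                iter n T x \in `[0, e k[]].
Proof.
move=> J e ehat alpha beta Jk G.
have [_ _ _ _ p_lt noret] := T_std.
split.
- by move=> [//|k] _ b1; exact: (saw_attracting T_saw b1).
- by move=> [//|k] _ b1 sum1; exact: (saw_cascade T_saw b1 sum1).
move=> [//|k] /andP[_ kk] sum1.
have kst2 : (k.+2 <= kst)%N by rewrite -ltn_predRL.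
apply: (saw_horseshoe T_saw sum1).
- by apply: p_lt.
- case: k {sum1} kk kst2 => [|k] kk kst2.
    by apply/ltW/(saw_p_lt_r0 T_saw).
  have [_ er _] := saw_eP T_saw k.
  by apply/ltW/(lt_trans _ er)/(p_lt k.+2); rewrite /= ltnW.
by apply: noret.
Qed.
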